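(* Fix $m,n\in\mathbb{N}$, $p\in(0,2]$ and let $X=(\mathbb{R}^m,\|\cdot\|_X)$ be an $m$-dimensional quasi-normed space which admits an isometric embedding into $L_p$. Then, for all unit vectors $\theta=(\theta_1,\ldots,\theta_n)$ and $\phi=(\phi_1,\ldots,\phi_n)$ in $\mathbb{R}^n$, we have $$(\theta_1^2,\ldots,\theta_n^2) \preceq (\phi_1^2,\ldots,\phi_n^2) \ \Longrightarrow\ \big| B_{p}^n(X) \cap H_\theta\big| \leq \big|B_p^n(X) \cap H_\phi\big|.$$ In particular, for every unit vector $\theta$ in $\mathbb{R}^n$, we have $$\big|B_{p}^{n}(X)\cap H_{\mathrm{diag}} \big| \leq \big|B_{p}^{n}(X)\cap H_\theta \big| \leq \big|B_{p}^{n-1}(X)\big|,$$ where $H_{\mathrm{diag}} = \big\{ (x_1,\ldots,x_n) \in(\mathbb{R}^m)^n: \ \sum_{i=1}^n x_i=0\big\}$.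
   Context: For a quasi-normed space $X=(\mathbb{R}^m,\|\cdot\|_X)$, $n\in\mathbb{N}$ and $p\in(0,\infty)$, $B_p^n(X)=\{(x_1,\ldots,x_n)\in(\mathbb{R}^m)^n:\ \sum_{i=1}^n\|x_i\|_X^p\leq 1\}$, viewed as a subset of $\mathbb{R}^{mn}$. For a unit vector (Euclidean norm) $\theta\in\mathbb{R}^n$, the block hyperplane is $H_\theta=\{(x_1,\ldots,x_n)\in(\mathbb{R}^m)^n:\ \sum_{i=1}^n\theta_i x_i=0\}$, a subspace of $\mathbb{R}^{mn}$ of dimension $m(n-1)$. $|\cdot|$ denotes Lebesgue measure of the appropriate dimension: on $H_\theta$ it is the $m(n-1)$-dimensional Lebesgue measure induced by the Euclidean structure of $\mathbb{R}^{mn}$ (in the degenerate case of dimension $0$, a single point has measure $1$). ''Isometric embedding into $L_p$'' means a linear map $J:X\to L_p$ (real-valued $L_p$, e.g. $L_p([0,1])$) with $\|Jx\|_{L_p}=\big(\int|Jx|^p\big)^{1/p}=\|x\|_X$ for all $x$. Majorization: for $\alpha,\beta\in\mathbb{R}^n$ with nonincreasing rearrangements $\alpha_1^*\geq\cdots\geq\alpha_n^*$ and $\beta_1^*\geq\cdots\geq\beta_n^*$, $\alpha\preceq\beta$ means $\sum_{j=1}^k\alpha_j^*\leq\sum_{j=1}^k\beta_j^*$ for every $k\in\{1,\ldots,n-1\}$ and $\sum_{j=1}^n\alpha_j=\sum_{j=1}^n\beta_j$. *)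

(* Defs.v *)
From HB Require Import structures.
From mathcomp Require Import all_boot all_order all_algebra.
From mathcomp Require Import all_classical all_reals all_analysis.

Set Implicit Arguments.
Unset Strict Implicit.
Unset Printing Implicit Defensive.

Import Order.TTheory GRing.Theory Num.Theory.
Import numFieldNormedType.Exports.

Local Open Scope classical_set_scope.
Local Open Scope ring_scope.

Section lebesgue_tuple_step.
Context {R : realType} {k : nat}.
Variable mu : {sigma_finite_measure set (k.-tuple (measurableTypeR R)) -> \bar R}.

Definition tuple_cons (xt : measurableTypeR R * k.-tuple (measurableTypeR R)) :
  k.+1.-tuple (measurableTypeR R) := [tuple of xt.1 :: xt.2].

Let measurable_tuple_cons : measurable_fun setT tuple_cons.
Proof. exact: (measurable_cons measurable_fst measurable_snd). Qed.

Definition lebesgue_tupleS : set (k.+1.-tuple (measurableTypeR R)) -> \bar R :=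
  pushforward (lebesgue_measure \x mu)%E tuple_cons.

HB.instance Definition _ := Measure.copy lebesgue_tupleS
  (measure_function_pushforward__canonical__measure_function_Measure
     ((lebesgue_measure \x mu)%E : {measure set _ -> \bar R})
     measurable_tuple_cons).

Let lebesgue_tupleS_sigma_finite : sigma_finite setT lebesgue_tupleS.
Proof.
have [[F UF mF]] :=
  lebesgue_integral_fubini.measure_function_Measure_isSigmaFinite__to__measure_function_isSigmaFinite
    (@lebesgue_measure R) mu.
pose g (t : k.+1.-tuple (measurableTypeR R)) :
    measurableTypeR R * k.-tuple (measurableTypeR R) :=
  (thead t, [tuple of behead t]).
have gK xt : g (tuple_cons xt) = xt.
  by rewrite [RHS]surjective_pairing /g; congr pair; apply: val_inj.
have mg : measurable_fun setT g.
  apply: measurable_fun_pair; first exact: measurable_tnth.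
  exact: measurable_behead.
exists (fun i => g @^-1` F i).
  by rewrite -preimage_bigcup -UF.
move=> i; have [mFi Fioo] := mF i; split.
  by rewrite -[X in measurable X]setTI; exact: mg.
rewrite /lebesgue_tupleS /pushforward -comp_preimage.
by rewrite (_ : g \o tuple_cons = id) //; apply/funext => xt; exact: gK.
Qed.

HB.instance Definition _ := Measure_isSigmaFinite.Build _ _ _
  lebesgue_tupleS lebesgue_tupleS_sigma_finite.

End lebesgue_tuple_step.

(* The k-fold product of the Lebesgue measure of R, i.e. the Lebesgue measure
   of R^k on its Borel sets; for k = 0 it gives mass 1 to the single point. *)
Fixpoint lebesgue_tuple (R : realType) (k : nat) :
    {sigma_finite_measure set (k.-tuple (measurableTypeR R)) -> \bar R} :=
  match k with
  | 0 => \d_[tuple]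
  | j.+1 => lebesgue_tupleS (lebesgue_tuple R j)
  end.

Section euclidean.
Context {R : realType} {n m : nat}.
Implicit Types (x y : 'M[R]_(n, m)) (A : set 'M[R]_(n, m)).

(* A vector (x_1, ..., x_n) of (R^m)^n = R^(mn) is the n x m matrix whose
   i-th row is x_i. *)
Definition edot x y : R := \sum_i \sum_j x i j * y i j.

Definition enorm x : R := Num.sqrt (edot x x).

Definition orthonormal_basis (U : {vspace 'M[R]_(n, m)})
    (b : (\dim U).-tuple 'M[R]_(n, m)) : Prop :=
  basis_of U b /\
  forall i j, edot (tnth b i) (tnth b j) = (i == j)%:R.

(* The measure of A `&` U for the Lebesgue measure of dimension \dim U that the
   Euclidean structure induces on the subspace U: transport of the Lebesgue
   measure of R^(\dim U) along the coordinates in an orthonormal basis of U.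
   Such a basis exists (Gram-Schmidt), so the default value of xget is not
   used, and the result does not depend on its choice, since the Lebesgue
   measure is invariant under orthogonal transformations. *)
Definition subspace_measure (U : {vspace 'M[R]_(n, m)}) A : \bar R :=
  let b := xget (vbasis U) [set b | orthonormal_basis b] in
  lebesgue_tuple R (\dim U) [set t | A (\sum_i (tnth t i : R) *: tnth b i)].

Definition matrix_measure A : \bar R :=
  lebesgue_tuple R (n * m) [set t | A (vec_mx (\row_i (tnth t i : R)))].

End euclidean.

Section block_hyperplane.
Context {R : realType} {n : nat} (m : nat).

Definition block_hyperplane (theta : 'rV[R]_n) : {vspace 'M[R]_(n, m)} :=
  lker (linfun (mulmx theta : 'M[R]_(n, m) -> 'rV[R]_m)).

Lemma block_hyperplaneP (theta : 'rV[R]_n) (x : 'M[R]_(n, m)) :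
  reflect (\sum_i theta ord0 i *: row i x = 0) (x \in block_hyperplane theta).
Proof. by rewrite memv_ker lfunE /= mulmx_sum_row; exact: eqP. Qed.

Definition block_diag_hyperplane : {vspace 'M[R]_(n, m)} :=
  block_hyperplane (const_mx 1).

Lemma block_diag_hyperplaneP (x : 'M[R]_(n, m)) :
  reflect (\sum_i row i x = 0) (x \in block_diag_hyperplane).
Proof.
rewrite (_ : \sum_i row i x = \sum_i (const_mx 1 : 'rV[R]_n) ord0 i *: row i x).
  exact: block_hyperplaneP.
by apply: eq_bigr => i _; rewrite mxE scale1r.
Qed.

End block_hyperplane.

Section quasi_normed.
Context {R : realType} {m : nat}.
Implicit Types N : 'rV[R]_m -> R.

Record quasi_norm N : Prop := {
  quasi_norm_ge0 : forall x, 0 <= N x ;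
  quasi_norm_eq0 : forall x, N x = 0 -> x = 0 ;
  quasi_normZ : forall (a : R) x, N (a *: x) = `|a| * N x ;
  quasi_normD : exists2 K : R, 1 <= K & forall x y, N (x + y) <= K * (N x + N y)
}.

(* L_p is taken over an arbitrary measure space. Its elements are classes of
   functions modulo equality almost everywhere, so J picks representatives and
   linearity holds almost everywhere only. *)
Definition isometrically_embeds_Lp N (p : R) : Prop :=
  exists (d : measure_display) (T : measurableType d)
         (mu : {measure set T -> \bar R}) (J : 'rV[R]_m -> T -> R),
  [/\ forall x, measurable_fun setT (J x),
      forall (a : R) x y,
        {ae mu, forall t, J (a *: x + y) t = a * J x t + J y t}
    & forall x, 'N[mu]_(p%:E)[EFin \o J x]%E = (N x)%:E].

Definition lp_ball (p : R) (n : nat) N : set 'M[R]_(n, m) :=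
  [set x | \sum_i N (row i x) `^ p <= 1].

End quasi_normed.

Arguments lp_ball {R m} p n N.

Section majorization.
Context {R : realType} {n : nat}.
Implicit Types a b : 'rV[R]_n.

Definition nonincreasing_rearrangement a : seq R :=
  sort >=%R [seq a ord0 i | i <- enum 'I_n].

Definition majorized a b : Prop :=
  (forall k : nat, (1 <= k <= n.-1)%N ->
    \sum_(j < k) (nonincreasing_rearrangement a)`_j <=
    \sum_(j < k) (nonincreasing_rearrangement b)`_j) /\
  \sum_i a ord0 i = \sum_i b ord0 i.

End majorization.

(* Main.v *)
From HB Require Import structures.
Require Import Defs.
From mathcomp Require Import all_boot all_order all_algebra.
From mathcomp Require Import all_classical all_reals all_analysis.
From mathcomp Require Import measurable_realfun ring lra.

(* Put S(x) = sum_i N(x_i)^p. By the layer cake formula and homogeneity, the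
   volume of the section of the ball by a subspace H is, up to a factor that
   depends only on dim H and p, the integral of exp(-S) over H.  Since N^p is an
   average of functions |<x, v>|^p with p <= 2, exp(-N^p) is a limit of positive
   combinations of Gaussians exp(-<A x, x>).  For Gaussians with matrices A_i, the
   integral over H_theta is proportional to
     prod_i (det A_i)^(-1/2) * det (sum_i theta_i^2 A_i^(-1))^(-1/2),
   and the last factor is, up to a constant, the integral over y in R^m of
   exp(- sum_i theta_i^2 <A_i^(-1) y, y>).  Expanding the product, the integral of
   prod_i g(x_i) over H_theta for a combination g of Gaussians is proportional to
   the integral over y of prod_i h(theta_i^2, y), where h(., y) is a positive sum of
   exponentials, hence log-convex: Karamata's inequality applies for each y. *)

Set Implicit Arguments.
Unset Strict Implicit.
Unset Printing Implicit Defensive.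

Import Order.TTheory GRing.Theory Num.Theory.
Import numFieldNormedType.Exports.

Local Open Scope classical_set_scope.
Local Open Scope ring_scope.

(** * Determinants and quadratic forms *)

(** Three obstacles shape the details. The passage from squares to p-th powers is usually a
    subordination integral; here it is a sum over the powers of a ratio rho > 1 whose relative error
    is at most rho - 1, so that only finite sums and pointwise limits occur. The rank-one forms <x,
    v>^2 are merely semidefinite, and a bounded limit of mixtures comes without an integrable
    majorant; both are cured by an extra factor exp(-e |t|^2), which an isometric parametrization of
    H_theta distributes over the blocks and which disappears at the end by monotone convergence.
    Finally, the measure space behind L_p is arbitrary and the embedding is linear only almost
    everywhere; N^p is therefore written with one vector-valued function, made of the images of the
    canonical basis, and that function is approximated by functions with finitely many values. The
    two extreme bounds are instances of the comparison: theta^2 = (1/n, ..., 1/n) is majorized by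
    every admissible vector, and (1, 0, ..., 0) majorizes all of them, its section being the ball
    with one block less. *)

Section determinants.
Variable R : fieldType.

Lemma det_mxdiag (n : nat) (s : 'I_n -> nat) (A : forall i, 'M[R]_(s i)) :
  \det (\mxdiag_i A i) = \prod_i \det (A i).
Proof.
elim: n => [|n IHn] in s A *.
  rewrite [RHS]big_ord0; move: (\mxdiag_i A i); rewrite big_ord0 => M.
  by rewrite det_mx00.
rewrite [RHS]big_ord_recl -IHn mxdiag_recl.
by case: _ / mxsize_recl; rewrite castmx_id det_ublock.
Qed.

(** Jacobi's identity for complementary minors, in an orthonormal frame. The stacked matrix [O] is
    orthogonal, and [O Q O^T] times the last block column of its inverse [O Q' O^T], completed by an
    identity block, is block triangular. *)
Lemma det_complementary_minor (d m k : nat) (B : 'M[R]_(d, k))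
    (C : 'M[R]_(m, k)) (Q Q' : 'M[R]_k) :
  (d + m)%N = k -> B *m B^T = 1%:M -> C *m C^T = 1%:M -> B *m C^T = 0 ->
  Q *m Q' = 1%:M ->
  \det (B *m Q *m B^T) = \det Q * \det (C *m Q' *m C^T).
Proof.
move=> kE; case: _ / kE in B C Q Q' * => BB CC BC QQ'.
have CB : C *m B^T = 0 by rewrite -(trmxK C) -trmx_mul BC trmx0.
pose O := col_mx B C.
have OO : O *m O^T = 1%:M.
  by rewrite /O tr_col_mx mul_col_row BB CC BC CB -scalar_mx_block.
have OO' : B^T *m B + C^T *m C = 1%:M.
  by rewrite -mul_row_col -tr_col_mx; exact: mulmx1C.
have dO : \det O * \det O = 1 by rewrite -{2}det_tr -det_mulmx OO det1.
have key : (O *m Q *m O^T) *m block_mx 1%:M (B *m Q' *m C^T) 0 (C *m Q' *m C^T)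
   = block_mx (B *m Q *m B^T) 0 (C *m Q *m B^T) 1%:M.
  rewrite {1}/O tr_col_mx mul_col_mx mul_col_row mulmx_block.
  rewrite !mulmx1 !mulmx0 !addr0.
  have E : forall l (P : 'M[R]_(l, d + m)),
      P *m Q *m B^T *m (B *m Q' *m C^T) + P *m Q *m C^T *m (C *m Q' *m C^T)
      = P *m C^T.
    move=> l P; rewrite !mulmxA -!mulmxDl -!(mulmxA (P *m Q)) -mulmxDr OO'.
    by rewrite mulmx1 -(mulmxA P Q) QQ' mulmx1.
  by rewrite !E CC BC.
have := congr1 determinant key.
rewrite !det_mulmx det_ublock det_lblock !det1 mul1r mulr1 det_tr => <-.
by congr (_ * _); rewrite mulrAC [X in X * _]dO mul1r.
Qed.

(** The orthogonal complement of the block hyperplane is spanned by the rows of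
    [C = (theta_1 I, ..., theta_n I)]. Jacobi's identity for the block diagonal matrix of the [A i]
    applies, and [C Q' C^T] involves the [theta i] only through their squares. *)
Lemma det_compression (n m d : nat) (B : 'I_n -> 'M[R]_(d, m))
    (theta : 'I_n -> R) (A A' : 'I_n -> 'M[R]_m) :
  (d + m = n * m)%N -> \sum_i B i *m (B i)^T = 1%:M ->
  \sum_i theta i *: B i = 0 -> \sum_i theta i ^+ 2 = 1 ->
  (forall i, A i *m A' i = 1%:M) ->
  \det (\sum_i B i *m A i *m (B i)^T) =
  (\prod_i \det (A i)) * \det (\sum_i theta i ^+ 2 *: A' i).
Proof.
move=> dm BB tB tt AA'.
have -> : \sum_i theta i ^+ 2 *: A' i = (\mxrow_i ((theta i)%:M : 'M[R]_m)) *m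
    (\mxdiag_i A' i) *m (\mxrow_i ((theta i)%:M : 'M[R]_m))^T.
  rewrite mul_mxrow_mxdiag tr_mxrow mul_mxrow_mxcol; apply: eq_bigr => i _.
  by rewrite tr_scalar_mx mul_scalar_mx mul_mx_scalar scalerA expr2.
have -> : \sum_i B i *m A i *m (B i)^T =
    (\mxrow_i B i) *m (\mxdiag_i A i) *m (\mxrow_i B i)^T.
  by rewrite mul_mxrow_mxdiag tr_mxrow mul_mxrow_mxcol.
rewrite -det_mxdiag; apply: det_complementary_minor.
- by rewrite dm sum_nat_const card_ord.
- by rewrite tr_mxrow mul_mxrow_mxcol.
- rewrite tr_mxrow mul_mxrow_mxcol.
  under eq_bigr do rewrite tr_scalar_mx -scalar_mxM -expr2.
  by rewrite -(raddf_sum (@scalar_mx R m)) tt.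
- rewrite tr_mxrow mul_mxrow_mxcol -[RHS]tB.
  by apply: eq_bigr => i _; rewrite tr_scalar_mx mul_mx_scalar.
- rewrite -mxdiagZ mul_mxdiag_mxblock; apply: eq_mxblock => i j.
  case: eqP => [ij|_]; last by rewrite mulmx0.
  by rewrite !conform_mx_id AA'.
Qed.

End determinants.

Section quadratic_forms.
Variable R : realFieldType.
Implicit Types (m n k : nat).

Definition quad m (A : 'M[R]_m) (x : 'rV[R]_m) : R := (x *m A *m x^T) 0 0.

Definition posdef m (A : 'M[R]_m) : Prop :=
  A^T = A /\ forall x, x != 0 -> 0 < quad A x.

Lemma quadD m (A B : 'M[R]_m) x : quad (A + B) x = quad A x + quad B x.
Proof. by rewrite /quad mulmxDr mulmxDl mxE. Qed.

Lemma quadZ m (A : 'M[R]_m) a x : quad (a *: A) x = a * quad A x.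
Proof. by rewrite /quad -scalemxAr -scalemxAl mxE. Qed.

Lemma quad_sum m (I : finType) (A : I -> 'M[R]_m) x :
  quad (\sum_i A i) x = \sum_i quad (A i) x.
Proof. by rewrite /quad mulmx_sumr mulmx_suml summxE. Qed.

Lemma quad_congr m k (B : 'M[R]_(k, m)) (A : 'M[R]_m) x :
  quad (B *m A *m B^T) x = quad A (x *m B).
Proof. by rewrite /quad trmx_mul !mulmxA. Qed.

Lemma quad1 m (x : 'rV[R]_m) : quad 1%:M x = \sum_i x 0 i ^+ 2.
Proof.
by rewrite /quad mulmx1 mxE; apply: eq_bigr => i _; rewrite mxE expr2.
Qed.

Lemma quad1_ge0 m (x : 'rV[R]_m) : 0 <= quad 1%:M x.
Proof. by rewrite quad1 sumr_ge0// => i _; exact: sqr_ge0. Qed.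

Lemma quad1_gt0 m (x : 'rV[R]_m) : x != 0 -> 0 < quad 1%:M x.
Proof.
move=> x0; rewrite lt_neqAle quad1_ge0 andbT eq_sym quad1.
apply: contraNneq x0 => /psumr_eq0P H; apply/eqP/rowP => i; rewrite mxE.
by apply/eqP; rewrite -sqrf_eq0 H// => j _; exact: sqr_ge0.
Qed.

Lemma posdef_unit m (A : 'M[R]_m) : posdef A -> A \in unitmx.
Proof.
move=> [_ A0]; rewrite -row_free_unit -kermx_eq0; apply/rowV0P => v.
rewrite sub_kermx => /eqP vA; apply/eqP; apply: contraT => /A0.
by rewrite /quad vA mul0mx mxE ltxx.
Qed.

Lemma posdef_inv m (A : 'M[R]_m) : posdef A -> posdef (invmx A).
Proof.
move=> pA; have uA := posdef_unit pA; case: pA => sA pA.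
split=> [|x x0]; first by rewrite trmx_inv sA.
have -> : quad (invmx A) x = quad A (x *m invmx A).
  by rewrite -quad_congr trmx_inv sA mulVmx// mul1mx.
by apply: pA; apply: contraNneq x0 => H; rewrite -(mulmxKV uA x) H mul0mx.
Qed.

Lemma posdef_sum m n (A : 'I_n -> 'M[R]_m) (c : 'I_n -> R) :
  (forall i, posdef (A i)) -> (forall i, 0 <= c i) -> \sum_i c i = 1 ->
  posdef (\sum_i c i *: A i).
Proof.
move=> pA c0 c1; split=> [|x x0].
  rewrite linear_sum/=; apply: eq_bigr => i _.
  by rewrite linearZ/= (pA i).1.
rewrite quad_sum; under eq_bigr do rewrite quadZ.
have cA i : 0 <= c i * quad (A i) x by rewrite mulr_ge0// ltW// (pA i).2.
rewrite lt_neqAle sumr_ge0// andbT; apply/eqP => /esym/psumr_eq0P H.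
have : \sum_i c i = 0.
  rewrite big1// => i _; have /eqP := H (fun j _ => cA j) i isT.
  by rewrite mulf_eq0 (gt_eqF ((pA i).2 _ x0)) orbF => /eqP.
by rewrite c1 => /eqP; rewrite oner_eq0.
Qed.

(** The squared norms of the blocks [x *m B i] add up to that of [x], so some block of a nonzero [x]
    is nonzero. *)
Lemma posdef_compression (n m d : nat) (B : 'I_n -> 'M[R]_(d, m))
    (A : 'I_n -> 'M[R]_m) :
  \sum_i B i *m (B i)^T = 1%:M -> (forall i, posdef (A i)) ->
  posdef (\sum_i B i *m A i *m (B i)^T).
Proof.
move=> BB pA; split=> [|x x0].
  rewrite linear_sum/=; apply: eq_bigr => i _.
  by rewrite !trmx_mul trmxK (pA i).1 mulmxA.
rewrite quad_sum; under eq_bigr do rewrite quad_congr.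
have cA i : 0 <= quad (A i) (x *m B i).
  have [->|y0] := eqVneq (x *m B i) 0; first by rewrite /quad !mul0mx mxE.
  exact/ltW/(pA i).2.
rewrite lt_neqAle sumr_ge0// andbT; apply/eqP => /esym/psumr_eq0P H.
have : quad 1%:M x = 0.
  rewrite -BB quad_sum big1// => i _.
  rewrite -[X in X *m _]mulmx1 quad_congr.
  have [->|y0] := eqVneq (x *m B i) 0; first by rewrite /quad !mul0mx mxE.
  by have := (pA i).2 _ y0; rewrite H ?ltxx.
by move/eqP; rewrite gt_eqF// quad1_gt0.
Qed.

(** Completing the square in the first variable; [M'] is the Schur complement. This is the induction
    step both for the sign of the determinant and for the Gaussian integral. *)
Lemma posdef_schur k (M : 'M[R]_(1 + k)) : posdef M ->
  exists (a : R) (b : 'rV[R]_k) (M' : 'M[R]_k),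
  [/\ 0 < a, posdef M', \det M = a * \det M' &
    forall s t, quad M (row_mx s%:M t) =
      a * (s + (t *m b^T) 0 0) ^+ 2 + quad M' t].
Proof.
move=> [sM pM]; pose a := ulsubmx M 0 0.
pose M' := drsubmx M - a^-1 *: ((ursubmx M)^T *m ursubmx M).
have dlE : dlsubmx M = (ursubmx M)^T by rewrite trmx_ursub sM.
have sD : (drsubmx M)^T = drsubmx M by rewrite trmx_drsub sM.
have ulE : ulsubmx M = a%:M by rewrite [LHS]mx11_scalar.
have quadE s t : quad M (row_mx s%:M t) =
    a * s ^+ 2 + 2 * s * (t *m (ursubmx M)^T) 0 0 + quad (drsubmx M) t.
  rewrite /quad -{1}(submxK M) mul_row_block tr_row_mx mul_row_col ulE dlE.
  rewrite tr_scalar_mx mul_mx_scalar !mul_scalar_mx mulmxDl -scalemxAl.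
  have : (ursubmx M *m t^T) 0 0 = (t *m (ursubmx M)^T) 0 0.
    by rewrite -[in RHS](trmxK (t *m _)) [RHS]mxE trmx_mul trmxK.
  move: (ursubmx M *m t^T) (t *m (ursubmx M)^T) (t *m drsubmx M *m t^T).
  by move=> u v w uv; rewrite !mxE uv eqxx mulr1n; ring.
have a0 : 0 < a.
  have : row_mx 1%:M (0 : 'rV[R]_k) != 0.
    apply/eqP => /(congr1 (fun A : 'M[R]_(1, 1 + k) => lsubmx A 0 0)).
    by rewrite row_mxKl !mxE eqxx => /eqP; rewrite oner_eq0.
  move=> /pM; rewrite quadE mul0mx !mxE /quad mul0mx mul0mx !mxE.
  by rewrite expr1n !mulr1 mulr0 !addr0.
have quadE' s t : quad M (row_mx s%:M t) =
      a * (s + a^-1 * (t *m (ursubmx M)^T) 0 0) ^+ 2 + quad M' t.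
  rewrite quadE quadD -scaleNr quadZ.
  have -> : quad ((ursubmx M)^T *m ursubmx M) t = (t *m (ursubmx M)^T) 0 0 ^+ 2.
    rewrite -[X in X *m ursubmx M]mulmx1 -{2}(trmxK (ursubmx M)) quad_congr.
    by rewrite quad1 big_ord1.
  by field; exact: lt0r_neq0.
exists a, (a^-1 *: ursubmx M), M'; split=> //; last first.
- by move=> s t; rewrite quadE' linearZ/= -scalemxAr [in RHS]mxE.
- have -> : M = block_mx 1%:M 0 (a^-1 *: (ursubmx M)^T) 1%:M *m
                 block_mx a%:M (ursubmx M) 0 M'.
    rewrite mulmx_block !mul1mx !mul0mx !addr0 -{1}(submxK M) ulE dlE.
    rewrite -scalemxAl mul_mx_scalar scalerA mulVf ?lt0r_neq0// scale1r.
    by rewrite /M' -scalemxAl addrC subrK.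
  by rewrite det_mulmx det_lblock det_ublock !det1 !mul1r det_scalar1.
- split=> [|x x0].
    by rewrite linearB linearZ/= trmx_mul trmxK sD.
  (* This first coordinate cancels the square, leaving [quad M' x]. *)
  have : row_mx (- (a^-1 * (x *m (ursubmx M)^T) 0 0))%:M x != 0.
    apply: contraNneq x0 => /(congr1 (@rsubmx R 1 1 k)).
    by rewrite row_mxKr linear0 => ->.
  by move=> /pM; rewrite quadE' addNr expr0n mulr0 add0r.
Qed.

Lemma posdef_det_gt0 k (M : 'M[R]_k) : posdef M -> 0 < \det M.
Proof.
elim: k => [|k IH] in M *; first by rewrite det_mx00 ltr01.
by move=> /(@posdef_schur k)[a [b [M' [a0 pM' -> _]]]]; rewrite mulr_gt0// IH.
Qed.

End quadratic_forms.

(** * Karamata inequality for sums of exponentials *)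

Section karamata.
Variable R : realType.

Lemma expR_tangent (x y : R) : expR x * (1 + (y - x)) <= expR y.
Proof.
rewrite -{2}(subrK x y) expRD mulrC ler_pM2r ?expR_gt0//.
exact: expR_ge1Dx.
Qed.

Definition expsum (I : finType) (w c : I -> R) (a : R) : R :=
  \sum_i w i * expR (- (a * c i)).

Lemma expsum_ge0 (I : finType) (w c : I -> R) a :
  (forall i, 0 <= w i) -> 0 <= expsum w c a.
Proof. by move=> w0; apply: sumr_ge0 => i _; rewrite mulr_ge0// expR_ge0. Qed.

(** The tangent inequality of [ln (expsum w c)], in multiplicative form so that it also covers
    vanishing weights, where the logarithm would be useless. *)
Lemma expsum_log_convex (I : finType) (w c : I -> R) :
  (forall i, 0 <= w i) ->
  exists s : R -> R, {homo s : a b / a <= b} /\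
    forall a b, expsum w c a * expR (s a * (b - a)) <= expsum w c b.
Proof.
move=> w0; have [w_eq0|] := pselect (forall i, w i = 0).
  exists (fun=> 0); split=> // a b.
  by rewrite /expsum !big1 ?mul0r// => i _; rewrite w_eq0 mul0r.
move=> /existsNP[i0 /eqP wi0].
have h_gt0 a : 0 < expsum w c a.
  rewrite /expsum (bigD1 i0)//= ltr_pwDl//.
    by rewrite mulr_gt0 ?expR_gt0// lt_neqAle eq_sym wi0 w0.
  by apply: sumr_ge0 => i _; rewrite mulr_ge0// expR_ge0.
(* The logarithmic derivative of [expsum w c] at [a]. *)
pose s a := - (\sum_i w i * expR (- (a * c i)) * c i) / expsum w c a.
have tangent a b : expsum w c a * expR (s a * (b - a)) <= expsum w c b.
  set x0 := s a * (b - a).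
  (* [x0] is the weighted mean of the exponents [- ((b - a) * c i)], so the first-order terms of the
     tangents to [expR] at [x0] cancel in the sum. *)
  have -> : expsum w c a * expR x0 =
      \sum_i (w i * expR (- (a * c i))) *
        (expR x0 * (1 + (- ((b - a) * c i) - x0))).
    have E : \sum_i w i * expR (- (a * c i)) * c i = - (s a * expsum w c a).
      by rewrite /s divfK ?opprK// gt_eqF.
    transitivity (expR x0 * ((1 - x0) * expsum w c a - (b - a) *
        \sum_i w i * expR (- (a * c i)) * c i)).
      by rewrite E /x0; ring.
    rewrite !mulr_sumr -sumrB mulr_sumr; apply: eq_bigr => i _; ring.
  apply: ler_sum => i _.
  have -> : - (b * c i) = - (a * c i) + - ((b - a) * c i) by ring.
  rewrite expRD [leRHS]mulrA ler_wpM2l ?expR_tangent//.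
  by rewrite mulr_ge0// expR_ge0.
exists s; split=> // a b; rewrite le_eqVlt => /predU1P[->//|ab].
(* Chaining the tangent inequalities from [b] to [a] and back bounds [expR ((s a - s b) * (b - a))]
   by 1. *)
have := le_trans (ler_wpM2r (expR_ge0 (s a * (b - a))) (tangent b a))
  (tangent a b).
rewrite -mulrA -expRD ger_pMr// -(expR0 R) ler_expR.
have -> : s b * (a - b) + s a * (b - a) = (s a - s b) * (b - a) by ring.
by rewrite pmulr_lle0 ?subr_gt0// subr_le0.
Qed.

(** Summation by parts: since the partial sums of [d] are nonnegative, lowering their coefficient
    from [s k] to [s k.+1] keeps the bound. The full sum is 0, so the sign of the last coefficient
    does not matter. *)
Lemma abel_ge0 (n : nat) (s d : nat -> R) :
  (forall j, (j.+1 < n)%N -> s j.+1 <= s j) ->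
  (forall k, (1 <= k <= n.-1)%N -> 0 <= \sum_(j < k) d j) ->
  \sum_(j < n) d j = 0 -> 0 <= \sum_(j < n) s j * d j.
Proof.
case: n => [|n] s_dec d0 dn; first by rewrite big_ord0.
suff H k : (k <= n)%N ->
    s k * \sum_(j < k.+1) d j <= \sum_(j < k.+1) s j * d j.
  by have := H _ (leqnn n); rewrite dn mulr0.
elim: k => [|k IH] kn; first by rewrite !big_ord1.
rewrite big_ord_recr [leRHS]big_ord_recr/= mulrDr lerD2r.
apply: le_trans (IH (ltnW kn)); apply: ler_wpM2r; last exact: s_dec.
by apply: d0; rewrite /= kn.
Qed.

Section rearrangement.
Variable n : nat.
Implicit Types a b : 'rV[R]_n.

Lemma perm_rearrangement a :
  perm_eq (nonincreasing_rearrangement a) [seq a ord0 i | i <- enum 'I_n].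
Proof. by rewrite /nonincreasing_rearrangement perm_sort. Qed.

Lemma size_rearrangement a : size (nonincreasing_rearrangement a) = n.
Proof. by rewrite (perm_size (perm_rearrangement a)) size_map size_enum_ord. Qed.

Lemma rearrangementP a j : (j < n)%N ->
  exists i, (nonincreasing_rearrangement a)`_j = a ord0 i.
Proof.
move=> jn; have := mem_nth 0 (_ : (j < size (nonincreasing_rearrangement a))%N).
rewrite size_rearrangement => /(_ jn).
by rewrite (perm_mem (perm_rearrangement a)) => /mapP[i _ ->]; exists i.
Qed.

Lemma rearrangement_ge a j k : (j <= k < n)%N ->
  (nonincreasing_rearrangement a)`_k <= (nonincreasing_rearrangement a)`_j.
Proof.
move=> /andP[jk kn].
have : sorted >=%R (nonincreasing_rearrangement a).
  by apply: sort_sorted => x y; exact: le_total.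
move=> /(sorted_leq_nth (fun y x z xy yz => le_trans yz xy) (@lexx _ _) 0).
by apply => //; rewrite inE size_rearrangement// (leq_ltn_trans jk).
Qed.

Lemma big_rearrangement (T : Type) (idx : T) (op : Monoid.com_law idx) a
    (f : R -> T) :
  \big[op/idx]_(j < n) f (nonincreasing_rearrangement a)`_j =
  \big[op/idx]_i f (a ord0 i).
Proof.
transitivity (\big[op/idx]_(x <- nonincreasing_rearrangement a) f x).
  by rewrite [RHS](big_nth 0) size_rearrangement big_mkord.
by rewrite (perm_big _ (perm_rearrangement a))/= big_map big_enum.
Qed.

(** Multiplying the tangent inequalities from each sorted entry of [a] to the corresponding one of
    [b] leaves the exponent [\sum_j s A_j * (B_j - A_j)]. It is nonnegative by Abel summation,
    because [s A_j] decreases in [j] and majorization controls the partial sums. *)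
Lemma karamata_expsum (I : finType) (w c : I -> R) a b :
  (forall i, 0 <= w i) -> majorized a b ->
  \prod_i expsum w c (a ord0 i) <= \prod_i expsum w c (b ord0 i).
Proof.
move=> w0 [ab_part ab_tot]; have [s [s_homo hs]] := expsum_log_convex c w0.
rewrite -(big_rearrangement _ a) -(big_rearrangement _ b)/=.
set A := nonincreasing_rearrangement a.
set B := nonincreasing_rearrangement b.
apply: (@le_trans _ _ (\prod_(j < n) (expsum w c A`_j *
    expR (s A`_j * (B`_j - A`_j))))); last first.
  apply: ler_prod => j _; rewrite hs andbT.
  by rewrite mulr_ge0 ?expR_ge0// expsum_ge0.
rewrite big_split/= ler_peMr//.
  by apply: prodr_ge0 => j _; exact: expsum_ge0.
rewrite -expR_sum -(expR0 R) ler_expR.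
apply: (@abel_ge0 n (fun j => s A`_j) (fun j => B`_j - A`_j)).
- by move=> j jn; apply/s_homo/rearrangement_ge; rewrite leqnSn.
- by move=> k kn; rewrite sumrB subr_ge0 ab_part.
- by rewrite sumrB !(big_rearrangement _ _ id) ab_tot subrr.
Qed.

End rearrangement.

Lemma majorized_const n (a : 'rV[R]_n) :
  \sum_i a ord0 i = 1 -> majorized (const_mx n%:R^-1) a.
Proof.
case: n => [|n] in a *.
  by rewrite big_ord0 => /eqP; rewrite eq_sym oner_eq0.
move=> a1; split; last first.
  rewrite a1; under eq_bigr do rewrite mxE.
  by rewrite sumr_const card_ord -[_ *+ _]mulr_natl divff// pnatr_eq0.
move=> k /= /andP[k0 kn]; set B := nonincreasing_rearrangement a.
have -> : \sum_(j < k)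
    (nonincreasing_rearrangement (const_mx n.+1%:R^-1 : 'rV[R]_n.+1))`_j
    = k%:R / n.+1%:R.
  rewrite -[k in RHS]card_ord mulr_natl -sumr_const; apply: eq_bigr => j _.
  have [|i ->] := @rearrangementP n.+1 (const_mx n.+1%:R^-1) j.
    by rewrite (leq_trans (ltn_ord j))// leqW.
  by rewrite mxE.
rewrite ler_pdivrMr ?ltr0n//.
have nE : n.+1 = (k + (n.+1 - k))%N by rewrite subnKC// leqW.
have Btot : \sum_(j < k) B`_j + \sum_(j < n.+1 - k) B`_(k + j) = 1.
  rewrite -a1 -(big_rearrangement _ a id)/=.
  rewrite -(big_mkord xpredT (fun j => B`_j)).
  rewrite -(big_mkord xpredT (fun j => B`_(k + j))).
  rewrite -(big_mkord xpredT (fun j => B`_j)).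
  rewrite [RHS](@big_cat_nat _ _ _ k)//= ?leqW//; congr (_ + _).
  by rewrite -[in RHS](add0n k) big_addn; apply: eq_bigr => j _; rewrite addnC.
(* The [k]-th largest entry separates the two groups: the mean of the first [k] entries is at least
   this entry, the mean of the others at most. *)
have lo : B`_k.-1 *+ k <= \sum_(j < k) B`_j.
  rewrite -[k in _ *+ k]card_ord -sumr_const; apply: ler_sum => j _.
  apply: rearrangement_ge; rewrite -ltnS prednK// ltn_ord/=.
  by rewrite (leq_trans kn).
have hi : \sum_(j < n.+1 - k) B`_(k + j) <= B`_k.-1 *+ (n.+1 - k).
  rewrite -[in leRHS](card_ord (n.+1 - k)) -sumr_const; apply: ler_sum => j _.
  apply: rearrangement_ge; rewrite (leq_trans (leq_pred k) (leq_addr _ _))/=.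
  by rewrite [X in (_ < X)%N]nE ltn_add2l.
move: lo hi Btot; rewrite -!(mulr_natr B`_k.-1).
have : (n.+1%:R : R) = k%:R + (n.+1 - k)%:R by rewrite -natrD -nE.
have : (0 : R) <= k%:R by exact: ler0n.
have : (0 : R) <= (n.+1 - k)%:R by exact: ler0n.
set S := \sum_(j < k) _; set T := \sum_(j < n.+1 - k) _.
move=> y0 x0 -> /(ler_wpM2l y0) lo /(ler_wpM2l x0) hi ST.
have : k%:R * (S + T) = k%:R :> R by rewrite ST mulr1.
by move: lo hi; lra.
Qed.

(** Partial sums of nonnegative entries with total 1 are at most 1, while those of the sorted unit
    vector are already at least 1 from the first entry on. *)
Lemma majorized_delta n (a : 'rV[R]_n.+1) :
  (forall i, 0 <= a ord0 i) -> \sum_i a ord0 i = 1 ->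
  majorized a (delta_mx ord0 ord0).
Proof.
move=> a0 a1; split; last first.
  rewrite a1 (bigD1 ord0)//= mxE !eqxx big1 ?addr0// => i i0.
  by rewrite mxE (negbTE i0).
move=> k /= /andP[k0 kn]; apply: (@le_trans _ _ 1).
  rewrite -a1 -(big_rearrangement _ a id)/=.
  rewrite -(big_mkord xpredT (fun j => (nonincreasing_rearrangement a)`_j)).
  rewrite -(big_mkord xpredT (fun j => (nonincreasing_rearrangement a)`_j)).
  rewrite [leRHS](@big_cat_nat _ _ _ k)//= ?leqW// lerDl big_nat.
  by apply: sumr_ge0 => j /andP[_ /(rearrangementP a)[i ->]].
case: k k0 kn => // k _ kn; rewrite big_ord_recl/= -[leLHS]addr0 lerD//.
  have : 1 \in nonincreasing_rearrangement (delta_mx ord0 ord0 : 'rV[R]_n.+1).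
    rewrite (perm_mem (perm_rearrangement _)); apply/mapP; exists ord0.
      by rewrite mem_enum.
    by rewrite mxE !eqxx.
  move=> /(nthP 0)[j]; rewrite size_rearrangement => jn <-.
  exact: rearrangement_ge.
apply: sumr_ge0 => j _.
have [|i ->] := @rearrangementP n.+1 (delta_mx ord0 ord0) (bump 0 j).
  by rewrite (leq_ltn_trans (ltn_ord j))// ltnW.
by rewrite mxE ler0n.
Qed.

End karamata.

(** * Lebesgue measure on tuples and Gaussian integrals *)

Section measurable_matrices.
Context {R : realType} {d : measure_display} {T : measurableType d}.

Definition measurable_mx (n m : nat) (A : T -> 'M[R]_(n, m)) : Prop :=
  forall i j, measurable_fun setT (fun t => A t i j).

Lemma measurable_mx_cst n m (A : 'M[R]_(n, m)) : measurable_mx (fun=> A).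
Proof. by move=> i j; exact: measurable_cst. Qed.

Lemma measurable_mulmx n m k (A : T -> 'M[R]_(n, m)) (B : T -> 'M[R]_(m, k)) :
  measurable_mx A -> measurable_mx B -> measurable_mx (fun t => A t *m B t).
Proof.
move=> mA mB i j; under eq_fun do rewrite mxE.
by apply: measurable_sum => l; exact: measurable_funM.
Qed.

Lemma measurable_trmx n m (A : T -> 'M[R]_(n, m)) :
  measurable_mx A -> measurable_mx (fun t => (A t)^T).
Proof. by move=> mA i j; under eq_fun do rewrite mxE; exact: mA. Qed.

Lemma measurable_quad m (A : 'M[R]_m) (x : T -> 'rV[R]_m) :
  measurable_mx x -> measurable_fun setT (fun t => quad A (x t)).
Proof.
move=> mx; apply: measurable_mulmx; last exact: measurable_trmx.
by apply: measurable_mulmx => //; exact: measurable_mx_cst.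
Qed.

End measurable_matrices.

Section lebesgue_tuple_theory.
Context {R : realType}.
Local Notation tup k := (k.-tuple (measurableTypeR R)).

Definition rowt k (t : tup k) : 'rV[R]_k := \row_i (tnth t i : R).

Lemma measurable_rowt k : measurable_mx (@rowt k).
Proof.
by move=> i j; under eq_fun do rewrite mxE; exact: measurable_tnth.
Qed.

Lemma rowt_cons k (s : R) (t : tup k) :
  rowt [tuple of (s : measurableTypeR R) :: t] =
  row_mx s%:M (rowt t) :> 'rV[R]_(1 + k).
Proof.
apply/rowP => j; rewrite !mxE; case: splitP => [i ij|i ij]; rewrite !mxE.
  rewrite (ord1 i) eqxx mulr1n; have -> : j = ord0.
    by apply/val_inj; rewrite /= ij (ord1 i).
  by rewrite tnth0.
have -> : j = lift ord0 i by apply/val_inj.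
by rewrite tnthS.
Qed.

Local Open Scope ereal_scope.

(** Tonelli, with the first coordinate innermost: it is the one that [posdef_schur] isolates. *)
Lemma integral_lebesgue_tupleS k (f : tup k.+1 -> \bar R) :
  measurable_fun setT f -> (forall t, 0 <= f t) ->
  \int[lebesgue_tuple R k.+1]_t f t =
  \int[lebesgue_tuple R k]_t \int[@lebesgue_measure R]_s
    f [tuple of (s : measurableTypeR R) :: t].
Proof.
move=> mf f0.
have mc : measurable_fun setT (@tuple_cons R k).
  exact: (measurable_cons measurable_fst measurable_snd).
etransitivity.
  exact: (ge0_integral_pushforward mc (lebesgue_measure \x lebesgue_tuple R k)
    measurableT mf (fun t _ => f0 t)).
rewrite preimage_setT fubini_tonelli2//; first exact: measurableT_comp.
by move=> x; exact: f0.
Qed.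

Lemma measurable_integral_cons k (f : tup k.+1 -> \bar R) :
  measurable_fun setT f -> (forall t, 0 <= f t) ->
  measurable_fun setT (fun t : tup k => \int[@lebesgue_measure R]_s
    f [tuple of (s : measurableTypeR R) :: t]).
Proof.
move=> mf f0.
have mc : measurable_fun setT (@tuple_cons R k).
  exact: (measurable_cons measurable_fst measurable_snd).
apply: (measurable_fun_fubini_tonelli_G (f \o @tuple_cons R k)).
  exact: measurableT_comp.
by move=> x; exact: f0.
Qed.

Lemma integral_lebesgue_tuple0 (f : tup 0 -> \bar R) :
  \int[lebesgue_tuple R 0]_t f t = f [tuple].
Proof.
have mf : measurable_fun setT f.
  have -> : f = cst (f [tuple]) by apply/funext => t; rewrite (tuple0 t).
  exact: measurable_cst.
by rewrite /= integral_dirac// diracT mul1e.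
Qed.

Lemma measurable_gauss_affine (a c : R) :
  measurable_fun setT (fun s : measurableTypeR R =>
    (expR (- (a * (s + c) ^+ 2)))%:E).
Proof.
apply/measurable_EFinP/measurableT_comp => //.
apply: measurableT_comp => //; apply: measurable_funM => //.
by apply: measurable_funX; apply: measurable_funD.
Qed.

Lemma integral_gauss_affine (a c : R) : (0 < a)%R ->
  \int[@lebesgue_measure R]_s (expR (- (a * (s + c) ^+ 2)))%:E =
  (Num.sqrt (pi / a))%:E.
Proof.
(* The integrand is, up to its peak value, the normal density with mean [- c] and variance
   [1 / (2 a)]. *)
move=> a0; set sg : R := Num.sqrt (2 * a)^-1.
have a20 : (0 < (2 * a)^-1)%R by rewrite invr_gt0 mulr_gt0.
have sg2 : (sg ^+ 2 = (2 * a)^-1)%R by rewrite sqr_sqrtr// ltW.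
have sg0 : (sg != 0)%R by rewrite gt_eqF// sqrtr_gt0.
have := @integral_normal_pdf R (- c) sg.
rewrite normal_pdfE//; under eq_integral do rewrite EFinM.
have -> : (normal_peak sg = (Num.sqrt (pi / a))^-1)%R.
  rewrite /normal_peak sg2; congr (Num.sqrt _)^-1%R.
  by field; rewrite gt_eqF.
have -> : normal_fun (- c) sg = (fun s => expR (- (a * (s + c) ^+ 2)))%R.
  apply/funext => s; rewrite /normal_fun sg2 opprK; congr expR.
  by field; rewrite gt_eqF.
have pa : (0 < Num.sqrt (pi / a) :> R)%R by rewrite sqrtr_gt0 divr_gt0// pi_gt0.
rewrite ge0_integralZl_EFin ?invr_ge0 ?(ltW pa)//=; last exact: measurable_gauss_affine.
move=> /(congr1 (fun x => (Num.sqrt (pi / a))%:E * x)).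
by rewrite muleA -EFinM divff ?gt_eqF// mul1e mule1.
Qed.

Lemma measurable_gauss_quad k (M : 'M[R]_k) :
  measurable_fun setT (fun t : tup k => (expR (- quad M (rowt t)))%:E).
Proof.
apply/measurable_EFinP/measurableT_comp => //.
by apply: measurableT_comp => //; apply: measurable_quad; exact: measurable_rowt.
Qed.

(** After completing the square, the inner integral is that of a Gaussian translated by a linear
    function of the remaining variables, hence a constant; the Schur complement carries the
    induction. *)
Lemma integral_gauss_quad k (M : 'M[R]_k) : posdef M ->
  \int[lebesgue_tuple R k]_t (expR (- quad M (rowt t)))%:E =
  (Num.sqrt (pi ^+ k / \det M))%:E.
Proof.
elim: k M => [M _|k IH M pM].
  rewrite integral_lebesgue_tuple0 det_mx00 divr1 expr0 sqrtr1.
  by rewrite /quad (flatmx0 (_^T)) mulmx0 mxE oppr0 expR0.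
have [a [b [M' [a0 pM' -> qE]]]] := @posdef_schur R k M pM.
have mq := measurable_gauss_quad M.
rewrite integral_lebesgue_tupleS//.
under eq_integral => t _.
  under eq_integral => s _.
    rewrite rowt_cons qE opprD expRD mulrC EFinM; over.
  rewrite ge0_integralZl_EFin ?expR_ge0//=; last exact: measurable_gauss_affine.
  rewrite integral_gauss_affine// muleC; over.
rewrite ge0_integralZl_EFin//; last exact: measurable_gauss_quad.
rewrite IH// -EFinM -sqrtrM ?divr_ge0 ?pi_ge0 ?ltW//.
by rewrite exprS invfM mulrACA.
Qed.

Definition scalet k (c : R) (t : tup k) : tup k :=
  [tuple ((c * tnth t i)%R : measurableTypeR R) | i < k].

Lemma rowt_scalet k c (t : tup k) : rowt (scalet c t) = (c *: rowt t)%R.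
Proof. by apply/rowP => i; rewrite !mxE tnth_mktuple. Qed.

Lemma measurable_scalet k c : measurable_fun setT (@scalet k c).
Proof.
apply/measurable_fun_tnthP => i.
rewrite (_ : _ \o _ = fun t : tup k => (c * tnth t i)%R : measurableTypeR R).
  by apply: measurable_funM => //; exact: measurable_tnth.
by apply/funext => t /=; rewrite tnth_mktuple.
Qed.

(** By uniqueness of the Lebesgue measure: [c] times the image measure under multiplication by [c]
    has the right value on the intervals []a, b]]. *)
Lemma lebesgue_measure_scale (c : R) (A : set R) : (0 < c)%R -> measurable A ->
  lebesgue_measure [set s | A (c * s)%R] = c^-1%:E * lebesgue_measure A.
Proof.
move=> c0 mA.
have mc : measurable_fun [set: measurableTypeR R]
    (( *%R c : measurableTypeR R -> measurableTypeR R)) by exact: measurable_funM.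
pose nu : {measure set (measurableTypeR R) -> \bar R} :=
  measure_function_pushforward__canonical__measure_function_Measure
  (@lebesgue_measure R) mc.
have c0' : (0 <= c)%R by exact: ltW.
have E : forall A, measurable A ->
    lebesgue_measure A = mscale (NngNum c0') nu A.
  apply: lebesgue_measure_unique => _ [[a b] _ <-] /=.
  rewrite /mscale /= /pushforward.
  have -> : (( *%R c : measurableTypeR R -> measurableTypeR R) @^-1`
      `]a, b]%classic) = `](c^-1 * a)%R, (c^-1 * b)%R]%classic.
    apply/seteqP; split=> s /=; rewrite !in_itv/=;
    by rewrite ltr_pdivrMl// ler_pdivlMl.
  rewrite !lebesgue_measure_itv/= !lte_fin ltr_pM2l ?invr_gt0//.
  case: ifP => _; last by rewrite mule0.
  by rewrite -!EFinB -EFinM -mulrBr mulrA divff ?gt_eqF// mul1r.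
by rewrite (E A mA) /mscale/= muleA -EFinM mulVf ?gt_eqF// mul1e.
Qed.

Lemma integral_lebesgue_scale (c : R) (f : R -> \bar R) : (0 < c)%R ->
  measurable_fun setT f -> (forall s, 0 <= f s) ->
  \int[@lebesgue_measure R]_s f (c * s)%R =
  c^-1%:E * \int[@lebesgue_measure R]_s f s.
Proof.
move=> c0 mf f0.
have mc : measurable_fun [set: measurableTypeR R]
    (( *%R c : measurableTypeR R -> measurableTypeR R)) by exact: measurable_funM.
have c0' : (0 <= c^-1)%R by rewrite invr_ge0 ltW.
transitivity (\int[mscale (NngNum c0') (@lebesgue_measure R)]_s f s); last first.
  by rewrite ge0_integral_mscale.
transitivity (\int[pushforward (@lebesgue_measure R)
    ( *%R c : measurableTypeR R -> measurableTypeR R)]_s f s).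
  exact/esym/(ge0_integral_pushforward mc _ measurableT mf (fun s _ => f0 s)).
apply: (@eq_measure_integral _ _ _ setT _
  (measure_function_pushforward__canonical__measure_function_Measure
     (@lebesgue_measure R) mc)) => A mA _.
exact: lebesgue_measure_scale.
Qed.

Lemma integral_scalet k (c : R) (f : tup k -> \bar R) : (0 < c)%R ->
  measurable_fun setT f -> (forall t, 0 <= f t) ->
  \int[lebesgue_tuple R k]_t f (scalet c t) =
  (c^-1 ^+ k)%:E * \int[lebesgue_tuple R k]_t f t.
Proof.
move=> c0; elim: k f => [|k IH] f mf f0.
  by rewrite !integral_lebesgue_tuple0 expr0 mul1e (tuple0 (scalet _ _)).
have c0' : (0 <= c^-1)%R by rewrite invr_ge0 ltW.
rewrite !integral_lebesgue_tupleS//; last first.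
  by apply: (measurableT_comp mf); exact: measurable_scalet.
have scE s (t : tup k) : scalet c [tuple of (s : measurableTypeR R) :: t] =
    [tuple of ((c * s)%R : measurableTypeR R) :: scalet c t].
  apply: eq_from_tnth => i; rewrite tnth_mktuple.
  by case: (unliftP ord0 i) => [j|] ->; rewrite ?tnth0// !tnthS tnth_mktuple.
have msec (t : tup k) :
    measurable_fun setT (fun s : measurableTypeR R => f [tuple of s :: t]).
  by apply: (measurableT_comp mf); exact: measurable_cons.
under eq_integral => t _.
  under eq_integral => s _ do rewrite scE.
  rewrite (@integral_lebesgue_scale c
    (fun s => f [tuple of (s : measurableTypeR R) :: scalet c t]))//;
    last exact: msec.
  over.
have mG := measurable_integral_cons mf f0.
rewrite ge0_integralZl_EFin//; last 2 first.
  by move=> t _; exact: integral_ge0.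
  by apply: (measurableT_comp mG); exact: measurable_scalet.
rewrite (IH _ mG); last by move=> t; exact: integral_ge0.
by rewrite muleA -EFinM exprS.
Qed.

Lemma lebesgue_tuple_scale k (c : R) (A : set (tup k)) : (0 < c)%R ->
  measurable A ->
  lebesgue_tuple R k [set t | A (scalet c t)] =
  (c^-1 ^+ k)%:E * lebesgue_tuple R k A.
Proof.
move=> c0 mA; have mcA : measurable [set t | A (scalet c t)].
  by rewrite -[X in measurable X]setTI; exact: measurable_scalet.
have mf : measurable_fun setT (EFin \o \1_A : tup k -> \bar R).
  by apply/measurable_EFinP; exact: measurable_indic.
have f0 t : 0 <= (EFin \o \1_A : tup k -> \bar R) t by rewrite lee_fin.
have := integral_scalet c0 mf f0.
have -> : \int[lebesgue_tuple R k]_t (EFin \o \1_A : tup k -> \bar R) (scalet c t) =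
    lebesgue_tuple R k [set t | A (scalet c t)].
  by have := integral_indic (lebesgue_tuple R k) measurableT mcA; rewrite setIT.
have -> // : \int[lebesgue_tuple R k]_t (EFin \o \1_A : tup k -> \bar R) t =
    lebesgue_tuple R k A.
by have := integral_indic (lebesgue_tuple R k) measurableT mA; rewrite setIT.
Qed.

End lebesgue_tuple_theory.

(** * Layer cake formula *)

Section layer_cake.
Context {R : realType}.
Local Open Scope ereal_scope.

Lemma integral_expRN (r a : R) : (0 < r)%R ->
  \int[@lebesgue_measure R]_(s in `[a, +oo[) (expR (- (r * s)))%:E =
  (expR (- (r * a)) / r)%:E.
Proof.
move=> r0; have cE : continuous (fun s : R => expR (- (r * s))).
  move=> x; apply: continuous_comp; last exact: continuous_expR.
  by apply: (@continuousN _ R^o); apply: continuousM => //; exact: cst_continuous.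
have cF : continuous (fun s : R => - (expR (- (r * s)) / r))%R.
  by move=> x; apply: cvgN; apply: cvgMl; exact: cE.
have dF (x : R) : is_derive x 1%R (fun s : R => - (expR (- (r * s)) / r))%R
    (expR (- (r * x))).
  apply: is_derive_eq.
  by rewrite /GRing.scale/=; field; rewrite gt_eqF.
rewrite (@ge0_continuous_FTC2y _ _ (fun s => - (expR (- (r * s)) / r))%R _ 0%R).
- by rewrite EFinN oppeK add0e.
- by move=> x _; exact: expR_ge0.
- exact: continuous_subspaceT.
- have -> : 0%R = (- (0 / r))%R by rewrite mul0r oppr0.
  apply: cvgN; apply: cvgMl.
  rewrite (_ : (fun x => expR (- (r * x))) =
    (fun z => expR (- z)) \o (fun z => r * z)%R)//.
  apply: (@cvg_comp _ _ _ _ _ _ (pinfty_nbhs R)); last exact: cvgr_expR.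
  exact: gt0_cvgMry.
- by move=> x _; exact: ex_derive.
- by apply/cvg_at_right_filter; exact: cF.
- by move=> x _; rewrite derive1E; exact: derive_val.
Qed.

(** Tonelli applied to [exp (- S t)] written as the integral of [exp (- s)] over [s >= S t]. *)
Lemma layer_cake_expR d (T : measurableType d)
    (mu : {sigma_finite_measure set T -> \bar R}) (S : T -> R) :
  measurable_fun setT S -> (forall t, 0 <= S t)%R ->
  \int[mu]_t (expR (- S t))%:E =
  \int[@lebesgue_measure R]_(s in `]0%R, +oo[)
    ((expR (- s))%:E * mu [set t | (S t <= s)%R]).
Proof.
move=> mS S0.
pose E := [set x : T * measurableTypeR R | (S x.1 <= x.2)%R] `&`
          [set x : T * measurableTypeR R | (0 < x.2)%R].
have mE : measurable E.
  apply: measurableI.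
    rewrite -[X in measurable X]setTI; apply: measurable_fun_le => //.
    exact: measurableT_comp.
  rewrite -[X in measurable X]setTI.
  have -> : [set x : T * measurableTypeR R | (0 < x.2)%R] =
    snd @^-1` `]0%R, +oo[%classic.
    by apply/seteqP; split=> x /=; rewrite in_itv/= andbT.
  exact: measurable_snd.
pose f (x : T * measurableTypeR R) : \bar R := (expR (- x.2) * \1_E x)%:E.
have mf : measurable_fun setT f.
  apply/measurable_EFinP/measurable_funM; last exact: measurable_indic.
  apply: measurableT_comp => //; exact: measurableT_comp.
have f0 x : 0 <= f x by rewrite lee_fin mulr_ge0// expR_ge0.
transitivity (\int[mu]_t \int[@lebesgue_measure R]_s f (t, s)).
  apply: eq_integral => t _.
  transitivity (\int[@lebesgue_measure R]_(s in `[S t, +oo[)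
      (expR (- (1 * s)))%:E); first by rewrite integral_expRN// mul1r divr1.
  (* Intersecting with []0, +oo[] changes the domain only when [S t = 0], and then by one point. *)
  transitivity (\int[@lebesgue_measure R]_(s in `[S t, +oo[ `&` `]0%R, +oo[)
      (expR (- (1 * s)))%:E).
    have mexp D : measurable_fun D (fun s : measurableTypeR R =>
        (expR (- (1 * s)))%:E).
      apply: measurable_funTS; apply/measurable_EFinP/measurableT_comp => //.
      by apply: measurableT_comp => //; exact: measurable_funM.
    have := S0 t; rewrite le_eqVlt => /predU1P[<-|St].
      rewrite -integral_itv_obnd_cbnd//; last exact: mexp.
      have -> // : `[0%R, +oo[ `&` `]0%R, +oo[ = `]0%R, +oo[%classic :> set R.
      apply/seteqP; split=> s /=; rewrite !in_itv/= !andbT; first by case.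
      by move=> s0; split=> //; exact: ltW.
    have -> // : `[S t, +oo[ `&` `]0%R, +oo[ = `[S t, +oo[%classic :> set R.
    apply/seteqP; split=> s /=; rewrite !in_itv/= !andbT; first by case.
    by move=> Ss; split=> //; exact: lt_le_trans Ss.
  rewrite integral_mkcond; apply: eq_integral => s _.
  rewrite /f /patch /= mul1r indicE.
  have -> : (s \in `[S t, +oo[ `&` `]0%R, +oo[) = ((t, s) \in E).
    by apply/idP/idP => /[!inE] -[]/=; rewrite !in_itv/= !andbT.
  by case: ifP => _; rewrite ?mulr1 ?mulr0.
rewrite fubini_tonelli// [RHS]integral_mkcond; apply: eq_integral => s _.
have mA : measurable [set t | (S t <= s)%R].
  by rewrite -[X in measurable X]setTI; exact: measurable_fun_le.
rewrite patchE; case: ifPn => [|/negP];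
  rewrite inE/= in_itv/= andbT => s0.
  transitivity (\int[mu]_t ((expR (- s))%:E *
      (\1_[set t | (S t <= s)%R] t)%:E)); last first.
    rewrite ge0_integralZl_EFin ?expR_ge0 ?integral_indic ?setIT//.
    by apply/measurable_EFinP; exact: measurable_indic.
  apply: eq_integral => t _; rewrite /f -EFinM !indicE/=; congr (_ * _%:R)%:E.
  by congr nat_of_bool; apply/idP/idP => /[!inE]; [case|split].
rewrite integral0_eq// => t _; rewrite /f indicE memNset ?mulr0//=.
by case.
Qed.

(** Euler's Gamma at [q + 1]. Only its positivity and finiteness matter: it is the factor that
    cancels between two sections. *)
Definition gamma_integral (q : R) : \bar R :=
  \int[@lebesgue_measure R]_(s in `]0%R, +oo[) (expR (- s) * s `^ q)%:E.

Lemma measurable_gamma_integrand (q : R) (D : set (measurableTypeR R)) :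
  measurable_fun D (fun s : measurableTypeR R => (expR (- s) * s `^ q)%:E).
Proof.
apply: measurable_funTS; apply/measurable_EFinP/measurable_funM => //.
by apply: measurableT_comp => //.
Qed.

Lemma gamma_integral_gt0 q : 0 <= q%:E -> 0 < gamma_integral q.
Proof.
rewrite lee_fin => q0.
apply: (@lt_le_trans _ _ (\int[@lebesgue_measure R]_(s in `[1%R, 2%R])
    (cst (expR (- 2))%:E) s)).
  by rewrite integral_cst//= lebesgue_measure_itv/= lte_fin ltr1n -EFinB
    mule_gt0 ?lte_fin ?expR_gt0// subr_gt0 ltr1n.
apply: (@le_trans _ _ (\int[@lebesgue_measure R]_(s in `[1%R, 2%R])
    (expR (- s) * s `^ q)%:E)).
  apply: ge0_le_integral => //.
  - by move=> s _; rewrite lee_fin expR_ge0.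
  - exact: measurable_gamma_integrand.
  - move=> s /=; rewrite in_itv/= lee_fin => /andP[s1 s2].
    rewrite -[leLHS]mulr1 ler_pM ?expR_ge0 ?ler_expR ?lerN2//.
    by rewrite -(powRr0 s) ler_powR.
apply: ge0_subset_integral => //.
- exact: measurable_gamma_integrand.
- by move=> s _; rewrite lee_fin mulr_ge0 ?expR_ge0 ?powR_ge0.
- move=> s /=; rewrite !in_itv/= andbT => /andP[s1 _].
  exact: lt_le_trans s1.
Qed.

Lemma gamma_integral_lty q : 0 <= q%:E -> gamma_integral q < +oo.
Proof.
rewrite lee_fin => q0.
(* For [q > 0], this is [s / (2 q) <= exp (s / (2 q))] raised to the power [q]; half of the
   exponential decay is kept for integrability. *)
have bound s : (0 < s)%R ->
    (expR (- s) * s `^ q <= (2 * q) `^ q * expR (- (2^-1 * s)))%R.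
  move=> s0; suff : (s `^ q <= (2 * q) `^ q * expR (2^-1 * s))%R.
    move=> /(ler_wpM2l (expR_ge0 (- s))) /le_trans; apply.
    by rewrite mulrCA -expRD ler_wpM2l ?powR_ge0// ler_expR; lra.
  move: q0; rewrite le_eqVlt => /predU1P[<-|q0].
    by rewrite !powRr0 mul1r -expR0 ler_expR mulr_ge0// ltW.
  have -> : (2^-1 * s = (s / (2 * q)) * q)%R by field; rewrite gt_eqF.
  rewrite expRM -powRM ?expR_ge0 ?mulr_ge0 ?(ltW q0)//.
  apply: ge0_ler_powR; rewrite ?nnegrE ?mulr_ge0 ?expR_ge0 ?(ltW q0) ?(ltW s0)//.
  have := expR_ge1Dx (s / (2 * q)).
  have : (0 < 2 * q)%R by rewrite mulr_gt0.
  move=> q20 /(ler_wpM2l (ltW q20)); apply: le_trans.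
  by rewrite mulrDr mulr1 mulrCA divff ?gt_eqF// mulr1 lerDr ltW.
apply: (@le_lt_trans _ _ (\int[@lebesgue_measure R]_(s in `[0%R, +oo[)
  ((2 * q) `^ q * expR (- (2^-1 * s)))%:E)); last first.
  under eq_integral do rewrite EFinM.
  rewrite ge0_integralZl_EFin ?powR_ge0//; last first.
    apply: measurable_funTS; apply/measurable_EFinP/measurableT_comp => //.
    by apply: measurableT_comp => //; exact: measurable_funM.
  by rewrite integral_expRN// -EFinM ltry.
have mb D : measurable_fun D (fun s : measurableTypeR R =>
    ((2 * q) `^ q * expR (- (2^-1 * s)))%:E).
  apply: measurable_funTS; apply/measurable_EFinP/measurable_funM => //.
  apply: measurableT_comp => //.
  by apply: measurableT_comp => //; exact: measurable_funM.
rewrite -integral_itv_obnd_cbnd//; last exact: mb.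
apply: ge0_le_integral => //=.
- by move=> s _; rewrite lee_fin mulr_ge0 ?expR_ge0 ?powR_ge0.
- exact: measurable_gamma_integrand.
- by move=> s; rewrite in_itv/= andbT lee_fin; exact: bound.
Qed.

(** The set [S <= s] is the dilate of [S <= 1] by [s^(1/p)], so its measure carries the factor
    [s^(k/p)]; the layer cake formula integrates that factor against [exp (- s)]. *)
Lemma integral_expR_homogeneous k (p : R)
    (S : k.-tuple (measurableTypeR R) -> R) : (0 < p)%R ->
  measurable_fun setT S -> (forall t, 0 <= S t)%R ->
  (forall c t, (0 < c)%R -> S (scalet c t) = c `^ p * S t)%R ->
  \int[lebesgue_tuple R k]_t (expR (- S t))%:E =
  gamma_integral (k%:R / p) * lebesgue_tuple R k [set t | (S t <= 1)%R].
Proof.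
move=> p0 mS S0 hS; rewrite layer_cake_expR//.
have mA : measurable [set t | (S t <= 1)%R].
  by rewrite -[X in measurable X]setTI; exact: measurable_fun_le.
rewrite -ge0_integralZr//; last 2 first.
  exact: measurable_gamma_integrand.
  by move=> s _; rewrite lee_fin mulr_ge0 ?expR_ge0 ?powR_ge0.
apply: eq_integral => s; rewrite inE/= in_itv/= andbT => s0.
rewrite EFinM -muleA; congr (_ * _).
have c0 : (0 < s `^ (- p^-1))%R by rewrite powR_gt0.
have -> : [set t | (S t <= s)%R] =
    [set t | [set t | (S t <= 1)%R] (scalet (s `^ (- p^-1)) t)].
  apply/seteqP; split=> t /=; rewrite hS// -powRrM mulNr mulVf ?gt_eqF//;
  by rewrite powR_inv1 ?(ltW s0)// ler_pdivrMl// mulr1.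
rewrite lebesgue_tuple_scale//; congr (_%:E * _).
rewrite -powRN opprK -powR_mulrn ?powR_ge0// -powRrM.
by rewrite mulrC.
Qed.

End layer_cake.

(** * Gaussian mixtures *)

Section gaussian_mixtures.
Context {R : realType}.
Local Notation tup k := (k.-tuple (measurableTypeR R)).

Definition gauss_mix m (I : finType) (w : I -> R) (A : I -> 'M[R]_m)
    (x : 'rV[R]_m) : R :=
  \sum_i w i * expR (- quad (A i) x).

Lemma integral_gauss_mix k (I : finType) (w : I -> R) (M : I -> 'M[R]_k) :
  (forall i, 0 <= w i) -> (forall i, posdef (M i)) ->
  (\int[lebesgue_tuple R k]_t (gauss_mix w M (rowt t))%:E =
   (\sum_i w i * Num.sqrt (pi ^+ k / \det (M i)))%:E)%E.
Proof.
move=> w0 pM; under eq_integral do rewrite /gauss_mix -sumEFin.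
rewrite ge0_integral_sum//; last 2 first.
- move=> i; apply/measurable_EFinP/measurable_funM => //.
  by apply/measurable_EFinP; exact: measurable_gauss_quad.
- by move=> i t _; rewrite lee_fin mulr_ge0// expR_ge0.
rewrite -sumEFin; apply: eq_bigr => i _.
under eq_integral do rewrite EFinM.
rewrite ge0_integralZl_EFin//; last exact: measurable_gauss_quad.
by rewrite integral_gauss_quad.
Qed.

Section block_frames.
Variables n m d : nat.

(* [B i] is the matrix of the [i]-th block [t |-> t *m B i] of an isometric
   parametrization of the block hyperplane of [theta]. *)
Definition block_frame (theta : 'rV[R]_n) (B : 'I_n -> 'M[R]_(d, m)) : Prop :=
  [/\ (d + m = n * m)%N, \sum_i B i *m (B i)^T = 1%:M,
      \sum_i theta ord0 i *: B i = 0 & \sum_i theta ord0 i ^+ 2 = 1].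

Lemma block_frame_norm theta B (t : 'rV[R]_d) : block_frame theta B ->
  \sum_i quad 1%:M (t *m B i) = quad 1%:M t.
Proof.
case=> _ BB _ _; rewrite -BB quad_sum; apply: eq_bigr => i _.
by rewrite -[X in X *m _^T]mulmx1 quad_congr.
Qed.

Lemma prod_gauss_mix (I : finType) (w : I -> R) (A : I -> 'M[R]_m)
    (B : 'I_n -> 'M[R]_(d, m)) (t : 'rV[R]_d) :
  \prod_i gauss_mix w A (t *m B i) =
  gauss_mix (fun f : {ffun 'I_n -> I} => \prod_i w (f i))
            (fun f => \sum_i B i *m A (f i) *m (B i)^T) t.
Proof.
rewrite /gauss_mix bigA_distr_bigA; apply: eq_bigr => f _.
rewrite big_split/= -expR_sum quad_sum sumrN; congr (_ * expR (- _)).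
by apply: eq_bigr => i _; rewrite quad_congr.
Qed.

(** The index set is that of [prod_gauss_mix], so the two expansions can be compared term by
    term. *)
Lemma prod_expsum (I : finType) (w : I -> R) (A : I -> 'M[R]_m)
    (theta : 'rV[R]_n) (y : 'rV[R]_m) :
  \prod_i expsum w (fun r => quad (A r) y) (theta ord0 i ^+ 2) =
  gauss_mix (fun f : {ffun 'I_n -> I} => \prod_i w (f i))
            (fun f => \sum_i theta ord0 i ^+ 2 *: A (f i)) y.
Proof.
rewrite /gauss_mix /expsum bigA_distr_bigA; apply: eq_bigr => f _.
rewrite big_split/= -expR_sum quad_sum sumrN; congr (_ * expR (- _)).
by apply: eq_bigr => i _; rewrite quadZ.
Qed.

(** The new weights absorb the factors [(det A_r)^(-1/2)]. The constant is the ratio of the powers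
    of [pi] in the Gaussian integrals of dimensions [d] and [m], hence the same for every
    [theta]. *)
Lemma integral_prod_gauss_mix (theta : 'rV[R]_n) (B : 'I_n -> 'M[R]_(d, m))
    (I : finType) (w : I -> R) (A : I -> 'M[R]_m) :
  block_frame theta B -> (forall i, 0 <= w i) -> (forall i, posdef (A i)) ->
  (\int[lebesgue_tuple R d]_t (\prod_i gauss_mix w A (rowt t *m B i))%:E =
   (Num.sqrt (pi ^+ d / pi ^+ m))%:E *
   \int[lebesgue_tuple R m]_y
     (\prod_i expsum (fun r => w r / Num.sqrt (\det (A r)))
        (fun r => quad (invmx (A r)) (rowt y)) (theta ord0 i ^+ 2))%:E)%E.
Proof.
move=> [dm BB tB tt] w0 pA.
under eq_integral do rewrite prod_gauss_mix.
under [in RHS]eq_integral do rewrite prod_expsum.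
have w0' i : 0 <= w i / Num.sqrt (\det (A i)) by rewrite divr_ge0.
have pN (f : {ffun 'I_n -> I}) :
    posdef (\sum_i theta ord0 i ^+ 2 *: invmx (A (f i))).
  apply: posdef_sum => // i; first exact: posdef_inv.
  exact: sqr_ge0.
have pM (f : {ffun 'I_n -> I}) :
    posdef (\sum_i B i *m A (f i) *m (B i)^T).
  exact: posdef_compression.
rewrite !integral_gauss_mix//; last 2 first.
- by move=> f; exact: prodr_ge0.
- by move=> f; exact: prodr_ge0.
rewrite -EFinM mulr_sumr; congr EFin; apply: eq_bigr => f _.
have pr0 : 0 < \prod_i \det (A (f i)).
  by apply: prodr_gt0 => i _; exact: posdef_det_gt0.
have N0 := posdef_det_gt0 (pN f); have pi0 := @pi_gt0 R.
rewrite (det_compression dm BB tB tt (A' := fun i => invmx (A (f i)))); last first.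
  by move=> i; rewrite mulmxV// posdef_unit.
have -> : \prod_i (w (f i) / Num.sqrt (\det (A (f i)))) =
    (\prod_i w (f i)) / Num.sqrt (\prod_i \det (A (f i))).
  rewrite prodf_div; congr (_ / _).
  apply: (big_rec2 (fun x y => x = Num.sqrt y)) => [|i x y _ ->].
    by rewrite sqrtr1.
  by rewrite sqrtrM// ltW// posdef_det_gt0.
rewrite mulrCA -mulrA; congr (_ * _).
have ip0 : 0 <= (\prod_i \det (A (f i)))^-1 by rewrite invr_ge0 ltW.
have pp0 : 0 <= pi ^+ d / pi ^+ m :> R by rewrite divr_ge0 ?exprn_ge0 ?ltW.
rewrite -sqrtrV ?(ltW pr0)// -(sqrtrM _ pp0) -(sqrtrM _ ip0).
congr Num.sqrt; field.
by rewrite !gt_eqF// exprn_gt0.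
Qed.

Lemma prod_gauss_mix_le (theta phi : 'rV[R]_n) (B B' : 'I_n -> 'M[R]_(d, m))
    (I : finType) (w : I -> R) (A : I -> 'M[R]_m) :
  block_frame theta B -> block_frame phi B' ->
  majorized (\row_i theta ord0 i ^+ 2) (\row_i phi ord0 i ^+ 2) ->
  (forall i, 0 <= w i) -> (forall i, posdef (A i)) ->
  (\int[lebesgue_tuple R d]_t (\prod_i gauss_mix w A (rowt t *m B i))%:E <=
   \int[lebesgue_tuple R d]_t (\prod_i gauss_mix w A (rowt t *m B' i))%:E)%E.
Proof.
move=> fB fB' tp w0 pA.
rewrite (integral_prod_gauss_mix fB)// (integral_prod_gauss_mix fB')//.
have w0' i : 0 <= w i / Num.sqrt (\det (A i)) by rewrite divr_ge0.
apply: lee_wpmul2l; first by rewrite lee_fin.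
have mh (th : 'rV[R]_n) : measurable_fun setT (fun y : tup m =>
     (\prod_i expsum (fun r => w r / Num.sqrt (\det (A r)))
        (fun r => quad (invmx (A r)) (rowt y)) (th ord0 i ^+ 2))%:E).
  under eq_fun do rewrite prod_expsum.
  apply/measurable_EFinP; apply: measurable_sum => f.
  apply: measurable_funM => //.
  by apply/measurable_EFinP; exact: measurable_gauss_quad.
apply: ge0_le_integral => //.
- by move=> y _; rewrite lee_fin; apply: prodr_ge0 => i _; exact: expsum_ge0.
- move=> y _; rewrite lee_fin.
  have := karamata_expsum (fun r => quad (invmx (A r)) (rowt y)) w0' tp.
  by under eq_bigr do rewrite mxE; under [leRHS]eq_bigr do rewrite mxE.
Qed.

End block_frames.

(** Semidefinite forms are needed for the rank-one squares [<x, v>^2], and for the zero form, which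
    makes constants mixtures. *)
Definition possemidef m (A : 'M[R]_m) : Prop :=
  A^T = A /\ forall x, 0 <= quad A x.

Lemma possemidefD m (A B : 'M[R]_m) :
  possemidef A -> possemidef B -> possemidef (A + B).
Proof.
move=> [sA A0] [sB B0]; split=> [|x]; first by rewrite linearD/= sA sB.
by rewrite quadD addr_ge0.
Qed.

Lemma possemidef0 m : possemidef (0 : 'M[R]_m).
Proof.
by split=> [|x]; [rewrite trmx0|rewrite /quad mulmx0 mul0mx mxE].
Qed.

(** Limits may be nested, which spares every diagonal extraction. The uniform bound [M] in each
    limit is what dominated convergence will use. *)
Inductive mixture m : ('rV[R]_m -> R) -> Prop :=
| mixture_fin (I : finType) w (A : I -> 'M[R]_m) :
    (forall i, 0 <= w i) -> (forall i, possemidef (A i)) ->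
    mixture (gauss_mix w A)
| mixture_lim (f_ : nat -> 'rV[R]_m -> R) f (M : R) :
    (forall k, mixture (f_ k)) -> (forall k x, f_ k x <= M) ->
    (forall x, f_ k x @[k --> \oo] --> f x) -> mixture f.

Section closure.
Variable m : nat.
Implicit Types f g : 'rV[R]_m -> R.

Lemma mixture_ge0 f : mixture f -> forall x, 0 <= f x.
Proof.
elim=> {f} [I w A w0 _|f_ f M _ IH _ cf] x.
  by apply: sumr_ge0 => i _; rewrite mulr_ge0// expR_ge0.
rewrite -(cvg_lim _ (cf x))//; apply: limr_ge; first exact: cvgP (cf x).
by near=> k; exact: IH.
Unshelve. all: by end_near. Qed.

Lemma mixture_bounded f : mixture f -> exists M, forall x, f x <= M.
Proof.
case=> {f} [I w A w0 A0|f_ f M _ fM cf].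
  exists (\sum_i w i) => x; apply: ler_sum => i _.
  by rewrite ler_piMr// -expR0 ler_expR oppr_le0 (A0 i).2.
exists M => x; rewrite -(cvg_lim _ (cf x))//.
apply: limr_le; first exact: cvgP (cf x).
by near=> k; exact: fM.
Unshelve. all: by end_near. Qed.

Lemma measurable_mixture f dsp (T : measurableType dsp) (X : T -> 'rV[R]_m) :
  mixture f -> measurable_mx X -> measurable_fun setT (f \o X).
Proof.
move=> + mX; elim=> {f} [I w A _ _|f_ f M _ IH _ cf].
  apply: measurable_sum => i; apply: measurable_funM => //.
  apply: measurableT_comp => //; apply: measurableT_comp => //.
  exact: measurable_quad.
by apply: measurable_fun_cvg IH _ => x _; exact: cf.
Qed.

(** Gaussians multiply by adding their forms. Limits are taken in one factor at a time, the other
    being fixed and bounded. *)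
Lemma mixture_mul f g : mixture f -> mixture g -> mixture (fun x => f x * g x).
Proof.
have base (I : finType) w (A : I -> 'M[R]_m) h : (forall i, 0 <= w i) ->
    (forall i, possemidef (A i)) -> mixture h ->
    mixture (fun x => gauss_mix w A x * h x).
  move=> w0 A0; elim=> {h} [J v C v0 C0|h_ h M mh IH hM ch].
    have -> : (fun x => gauss_mix w A x * gauss_mix v C x) =
        gauss_mix (fun ij : I * J => w ij.1 * v ij.2) (fun ij => A ij.1 + C ij.2).
      apply/funext => x; rewrite /gauss_mix big_distrlr pair_bigA.
      by apply: eq_bigr => -[i j] _ /=; rewrite quadD opprD expRD mulrACA.
    by apply: mixture_fin => -[i j] /=; [exact: mulr_ge0|exact: possemidefD].
  have mA := mixture_fin w0 A0; have [N AN] := mixture_bounded mA.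
  apply: (mixture_lim (M := N * M) IH) => [k x|x].
    by apply: ler_pM => //; exact: mixture_ge0.
  by apply: cvgM => //; exact: cvg_cst.
elim=> {f} [I w A w0 A0 mg|f_ f M mf IH fM cf mg]; first exact: base.
have [N gN] := mixture_bounded mg.
apply: (mixture_lim (M := M * N) (fun k => IH k mg)) => [k x|x].
  by apply: ler_pM => //; exact: mixture_ge0.
by apply: cvgM => //; exact: cvg_cst.
Qed.

Lemma mixture_add f g : mixture f -> mixture g -> mixture (fun x => f x + g x).
Proof.
have base (I : finType) w (A : I -> 'M[R]_m) h : (forall i, 0 <= w i) ->
    (forall i, possemidef (A i)) -> mixture h ->
    mixture (fun x => gauss_mix w A x + h x).
  move=> w0 A0; elim=> {h} [J v C v0 C0|h_ h M mh IH hM ch].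
    have -> : (fun x => gauss_mix w A x + gauss_mix v C x) =
        gauss_mix (fun ij : I + J => match ij with inl i => w i | inr j => v j end)
          (fun ij => match ij with inl i => A i | inr j => C j end).
      by apply/funext => x; rewrite /gauss_mix big_sumType.
    by apply: mixture_fin => -[i|j].
  have mA := mixture_fin w0 A0; have [N AN] := mixture_bounded mA.
  apply: (mixture_lim (M := N + M) IH) => [k x|x]; first exact: lerD.
  by apply: cvgD => //; exact: cvg_cst.
elim=> {f} [I w A w0 A0 mg|f_ f M mf IH fM cf mg]; first exact: base.
have [N gN] := mixture_bounded mg.
apply: (mixture_lim (M := M + N) (fun k => IH k mg)) => [k x|x].
  exact: lerD.
by apply: cvgD => //; exact: cvg_cst.
Qed.

Lemma mixture_gauss (A : 'M[R]_m) : possemidef A ->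
  mixture (fun x => expR (- quad A x)).
Proof.
move=> A0; have -> : (fun x => expR (- quad A x)) =
    gauss_mix (fun=> 1) (fun _ : unit => A).
  by apply/funext => x; rewrite /gauss_mix big_const card_unit/= mul1r addr0.
by apply: mixture_fin.
Qed.

Lemma mixture_cst c : 0 <= c -> mixture (fun _ : 'rV[R]_m => c).
Proof.
move=> c0; have -> : (fun _ : 'rV[R]_m => c) =
    gauss_mix (fun=> c) (fun _ : unit => 0 : 'M[R]_m).
  apply/funext => x; rewrite /gauss_mix big_const card_unit/= /quad.
  by rewrite mulmx0 mul0mx mxE oppr0 expR0 mulr1 addr0.
by apply: mixture_fin => // _; exact: possemidef0.
Qed.

(** The partial sums of the exponential series have nonnegative terms, so they are mixtures bounded
    by [expR M]. *)
Lemma mixture_expR f : mixture f -> mixture (fun x => expR (f x)).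
Proof.
move=> mf; have [M fM] := mixture_bounded mf.
have powf r : mixture (fun x => f x ^+ r).
  elim: r => [|r IH]; first by under eq_fun do rewrite expr0; exact: mixture_cst.
  by under eq_fun do rewrite exprS; exact: mixture_mul.
have ser k : mixture (fun x => series (exp_coeff (f x)) k).
  elim: k => [|k IH].
    under eq_fun do rewrite /series/= big_geq//.
    exact: mixture_cst.
  under eq_fun do rewrite seriesSr.
  apply: mixture_add => //; rewrite /exp_coeff/=.
  by apply: mixture_mul => //; apply: mixture_cst; rewrite invr_ge0.
apply: (mixture_lim (M := expR M) ser) => [k x|x]; last first.
  exact: is_cvg_series_exp_coeff.
apply: (@le_trans _ _ (expR (f x))); last by rewrite ler_expR.
apply: nondecreasing_cvgn_le; last exact: is_cvg_series_exp_coeff.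
apply: nondecreasing_series => i _ _; rewrite /exp_coeff/=.
by rewrite divr_ge0// exprn_ge0// mixture_ge0.
Qed.

End closure.

(** The factor with [e] has two roles: for finite mixtures it turns each [A i] into the positive
    definite [A i + e I], and for limits it yields the integrable majorant [M^n exp (- e |t|^2)]. *)
Lemma mixture_block_le n m d (theta phi : 'rV[R]_n)
    (B B' : 'I_n -> 'M[R]_(d, m)) (f : 'rV[R]_m -> R) (e : R) :
  block_frame theta B -> block_frame phi B' ->
  majorized (\row_i theta ord0 i ^+ 2) (\row_i phi ord0 i ^+ 2) ->
  mixture f -> 0 < e ->
  (\int[lebesgue_tuple R d]_t
     (expR (- (e * quad 1%:M (rowt t))) * \prod_i f (rowt t *m B i))%:E <=
   \int[lebesgue_tuple R d]_t
     (expR (- (e * quad 1%:M (rowt t))) * \prod_i f (rowt t *m B' i))%:E)%E.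
Proof.
move=> fB fB' tp + e0; elim=> {f} [I w A w0 A0|f_ f M mf IH fM cf].
  have pA i : posdef (A i + e *: 1%:M).
    have [sA A0'] := A0 i; split=> [|x x0].
      by rewrite linearD linearZ/= sA trmx1.
    by rewrite quadD quadZ ltr_wpDl// mulr_gt0// quad1_gt0.
  (* A block frame is isometric, so [e |t|^2] splits into the contributions of the [n] blocks. *)
  have E th (C : 'I_n -> 'M[R]_(d, m)) t : block_frame th C ->
      expR (- (e * quad 1%:M t)) * \prod_i gauss_mix w A (t *m C i) =
      \prod_i gauss_mix w (fun i => A i + e *: 1%:M) (t *m C i).
    move=> fC; rewrite -(block_frame_norm _ fC) mulr_sumr -sumrN expR_sum.
    rewrite -big_split/=; apply: eq_bigr => i _.
    rewrite /gauss_mix mulr_sumr; apply: eq_bigr => j _.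
    by rewrite quadD quadZ opprD expRD mulrCA [expR _ * _]mulrC.
  under eq_integral do rewrite (E _ _ _ fB).
  under [leRHS]eq_integral do rewrite (E _ _ _ fB').
  exact: (prod_gauss_mix_le fB fB' tp w0 pA).
have mL (C : 'I_n -> 'M[R]_(d, m)) i :
    measurable_mx (fun t : tup d => rowt t *m C i).
  by apply: measurable_mulmx; [exact: measurable_rowt|exact: measurable_mx_cst].
have mlim : mixture f by exact: mixture_lim fM cf.
have mg h (C : 'I_n -> 'M[R]_(d, m)) : mixture h -> measurable_fun setT
    (fun t : tup d =>
      (expR (- (e * quad 1%:M (rowt t))) * \prod_i h (rowt t *m C i))%:E).
  move=> mh; apply/measurable_EFinP/measurable_funM; last first.
    by apply: measurable_prod => i _; exact: measurable_mixture (mL C i).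
  apply: measurableT_comp => //; apply: measurableT_comp => //.
  apply: measurable_funM => //; apply: measurable_quad.
  exact: measurable_rowt.
have cvgI (C : 'I_n -> 'M[R]_(d, m)) :
  ((\int[lebesgue_tuple R d]_t (expR (- (e * quad 1%:M (rowt t))) *
     \prod_i f_ k (rowt t *m C i))%:E) @[k --> \oo] -->
  \int[lebesgue_tuple R d]_t (expR (- (e * quad 1%:M (rowt t))) *
     \prod_i f (rowt t *m C i))%:E)%E.
  have [] := @dominated_convergence _ _ _ (lebesgue_tuple R d) setT measurableT
    (fun k t => (expR (- (e * quad 1%:M (rowt t))) *
       \prod_i f_ k (rowt t *m C i))%:E)
    (fun t => (expR (- (e * quad 1%:M (rowt t))) *
       \prod_i f (rowt t *m C i))%:E)
    (fun t => (M ^+ n * expR (- quad (e *: 1%:M) (rowt t)))%:E).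
  - by move=> k; exact: mg.
  - exact: mg.
  - apply: aeW => t _; apply: cvg_EFin; first by near=> k.
    apply: cvgM; first exact: cvg_cst.
    elim: (index_enum _) => [|i s IHs].
      by under eq_fun do rewrite big_nil; rewrite big_nil; exact: cvg_cst.
    under eq_fun do rewrite big_cons.
    by rewrite big_cons; apply: cvgM; [exact: cf|exact: IHs].
  - have M0 : 0 <= M by apply: le_trans (fM 0%N 0); exact: mixture_ge0.
    apply/integrableP; split.
      apply/measurable_EFinP/measurable_funM => //.
      by apply/measurable_EFinP; exact: measurable_gauss_quad.
    under eq_integral => t _.
      rewrite gee0_abs ?lee_fin ?mulr_ge0 ?exprn_ge0 ?expR_ge0// EFinM; over.
    rewrite ge0_integralZl_EFin ?exprn_ge0//; last exact: measurable_gauss_quad.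
    rewrite integral_gauss_quad -?EFinM ?ltry//.
    split=> [|x x0]; first by rewrite linearZ/= trmx1.
    by rewrite quadZ mulr_gt0// quad1_gt0.
  - apply: aeW => t k _; rewrite gee0_abs; last first.
      rewrite lee_fin mulr_ge0 ?expR_ge0//.
      by apply: prodr_ge0 => i _; exact: mixture_ge0.
    rewrite lee_fin quadZ mulrC ler_wpM2r ?expR_ge0//.
    rewrite -[n in _ ^+ n]card_ord -prodr_const.
    apply: ler_prod => i _; rewrite fM andbT; exact: mixture_ge0.
  by [].
apply: (@lee_cvg_to _ _ _ _ _ _ _ _ (cvgI B) (cvgI B')).
by near=> k; exact: IH.
Unshelve. all: by end_near. Qed.

End gaussian_mixtures.

(** * Bernstein functions *)

(** Both [q] and [X] lie in [[Y, r Y]], whose length is at most [(rho - 1) X]. *)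
Lemma sandwich_dist (R : realFieldType) (rho r X Y q : R) :
  1 <= r -> r <= rho -> 0 <= Y -> Y <= X -> X <= r * Y -> Y <= q -> q <= r * Y ->
  `|q - X| <= (rho - 1) * X.
Proof.
move=> r1 rr Y0 YX XrY Yq qrY.
have h1 : (r - 1) * Y <= (rho - 1) * X.
  by apply: ler_pM; rewrite ?subr_ge0// lerD2r.
by rewrite ler_norml; apply/andP; split; move: h1; rewrite mulrBl mul1r; lra.
Qed.

(** * Approximation of powers by log-periodic sums *)

Section log_periodic_sum.
Context {R : realType}.
Variables (rho al : R).
Hypotheses (rho1 : 1 < rho) (al0 : 0 < al) (al1 : al < 1).

Let g (x : R) : R := 1 - expR (- x).
Let s : R := rho `^ (- al).
Let a (x : R) (l : nat) : R := g (x * rho ^+ l) * s ^+ l.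
Let b (x : R) (l : nat) : R := g (x / rho ^+ l) / s ^+ l.

(* Partial sums of the sum over all integers [l] of
   [(1 - exp (- x rho^l)) rho^(- al l)]; the term [n] of the series groups the
   indices [n] and [-(n+1)]. *)
Definition log_periodic_series (x : R) : nat -> R :=
  series (fun l => a x l + b x l.+1).

(** Its quotient by [x^al] is, for [x > 0], a periodic function of [ln x] with period [ln rho]. *)
Definition log_periodic_sum (x : R) : R := limn (log_periodic_series x).

Let rho0 : 0 < rho. Proof. exact: lt_trans rho1. Qed.

Let s0 : 0 < s. Proof. exact: powR_gt0. Qed.

Let sV : s^-1 = rho `^ al. Proof. by rewrite /s powRN invrK. Qed.

Let s1 : s < 1.
Proof.
rewrite -[s]invrK invf_lt1 ?invr_gt0// sV -(powRr0 rho).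
by rewrite /powR gt_eqF// ltr_expR ltr_pM2r// ln_gt0.
Qed.

Let rs1 : (rho * s)^-1 < 1.
Proof.
rewrite invf_lt1 ?mulr_gt0// -{1}(powRr1 (ltW rho0)) -powRD; last first.
  by apply/implyP => _; rewrite gt_eqF.
by rewrite /powR gt_eqF// -[ltLHS]expR0 ltr_expR mulr_gt0 ?subr_gt0 ?ln_gt0.
Qed.

Let g_ge0 x : 0 <= x -> 0 <= g x.
Proof. by move=> x0; rewrite subr_ge0 -expR0 ler_expR oppr_le0. Qed.

Let g_le1 x : g x <= 1. Proof. by rewrite gerBl expR_ge0. Qed.

Let g_lex x : g x <= x.
Proof. by have := expR_ge1Dx (- x); rewrite /g; lra. Qed.

Let g_homo x y : x <= y -> g x <= g y.
Proof. by move=> xy; rewrite lerD2l lerN2 ler_expR lerN2. Qed.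

Let a_ge0 x l : 0 <= x -> 0 <= a x l.
Proof.
move=> x0; rewrite mulr_ge0 ?exprn_ge0 ?(ltW s0)//.
by rewrite g_ge0// mulr_ge0// exprn_ge0// ltW.
Qed.

Let b_ge0 x l : 0 <= x -> 0 <= b x l.
Proof.
move=> x0; rewrite divr_ge0 ?exprn_ge0 ?(ltW s0)//.
by rewrite g_ge0// divr_ge0// exprn_ge0// ltW.
Qed.

Let a_le x l : a x l <= s ^+ l.
Proof. by rewrite ler_piMl// exprn_ge0// ltW. Qed.

Let b_le x l : b x l <= x * (rho * s)^-1 ^+ l.
Proof.
rewrite /b exprVn exprMn invfM mulrA ler_wpM2r//.
by rewrite invr_ge0 exprn_ge0// ltW.
Qed.

(** Two geometric majorants: [g <= 1] gives the ratio [s = rho^(- al)] for the indices [l >= 0], and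
    [g x <= x] gives the ratio [rho^(al - 1)] for the negative ones. They are below 1 because
    [0 < al < 1]. *)
Lemma log_periodic_cvg x : 0 <= x -> cvgn (log_periodic_series x).
Proof.
move=> x0; pose t := (rho * s)^-1.
have t0 : 0 <= t by rewrite invr_ge0 mulr_ge0 ?ltW.
apply: (@series_le_cvg _ (fun l => a x l + b x l.+1)
  (geometric 1 s + geometric (x * t) t)).
- by move=> l; apply: addr_ge0; [exact: a_ge0|exact: b_ge0].
- by move=> l; apply: addr_ge0; rewrite !mulr_ge0 ?exprn_ge0// ltW.
- move=> l; apply: lerD; rewrite /=; first by rewrite mul1r.
  by rewrite -mulrA -exprS.
- apply: is_cvg_seriesD; apply: is_cvg_geometric_series.
    by rewrite ger0_norm// ltW.
  by rewrite ger0_norm.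
Qed.

(** Replacing [x] by [rho x] shifts the two-sided sum by one index; the last summand is the boundary
    effect of truncation, which tends to 0. *)
Let shift_series x L : s * log_periodic_series (rho * x) L =
  log_periodic_series x L + (a x L - b x L).
Proof.
rewrite /log_periodic_series; elim: L => [|L IH].
  by rewrite /series/= !big_geq// mulr0 add0r /a /b !expr0 !mulr1 !divr1 subrr.
rewrite !seriesSr mulrDr IH.
have sN0 : s != 0 by rewrite gt_eqF.
have rN0 : rho != 0 by rewrite gt_eqF.
have -> : s * (a (rho * x) L + b (rho * x) L.+1) = a x L.+1 + b x L.
  rewrite mulrDr; congr (_ + _).
    by rewrite /a mulrCA -exprS mulrAC mulrC -exprS (mulrC _ x) mulrC.
  rewrite /b !exprS.
  have -> : rho * x / (rho * rho ^+ L) = x / rho ^+ L.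
    by field; rewrite expf_neq0.
  by field; rewrite expf_neq0.
by ring.
Qed.

Lemma log_periodic_shift x : 0 <= x ->
  log_periodic_sum (rho * x) = rho `^ al * log_periodic_sum x.
Proof.
move=> x0; have rx0 : 0 <= rho * x by rewrite mulr_ge0// ltW.
have ca : a x L @[L --> \oo] --> 0.
  have le0 : \forall L \near \oo, 0 <= a x L <= geometric 1 s L.
    by near=> L; rewrite a_ge0//= mul1r a_le.
  apply: (squeeze_cvgr le0); first exact: cvg_cst.
  by apply: cvg_geometric; rewrite ger0_norm// ltW.
have cb : b x L @[L --> \oo] --> 0.
  have le0 : \forall L \near \oo, 0 <= b x L <= geometric x (rho * s)^-1 L.
    by near=> L; rewrite b_ge0//=.
  apply: (squeeze_cvgr le0); first exact: cvg_cst.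
  by apply: cvg_geometric; rewrite ger0_norm// invr_ge0 mulr_ge0 ?ltW.
have H : log_periodic_series x L + (a x L - b x L) @[L --> \oo] -->
    log_periodic_sum x + (0 - 0).
  by apply: cvgD; [exact: log_periodic_cvg|exact: cvgB].
have H' : s * log_periodic_series (rho * x) L @[L --> \oo] -->
    s * log_periodic_sum (rho * x).
  by apply: cvgMr; exact: log_periodic_cvg.
have E : s * log_periodic_sum (rho * x) = log_periodic_sum x.
  transitivity (log_periodic_sum x + (0 - 0)); last by rewrite subrr addr0.
  rewrite -(cvg_lim _ H)// -(cvg_lim _ H')//.
  by congr (lim _); under eq_fun do rewrite shift_series.
by rewrite -E -sV mulrA mulVf ?mul1r// gt_eqF.
Unshelve. all: by end_near. Qed.

Lemma log_periodic_le x y : 0 <= x -> x <= y ->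
  log_periodic_sum x <= log_periodic_sum y.
Proof.
move=> x0 xy; apply: lim_series_le.
- exact: log_periodic_cvg.
- exact/log_periodic_cvg/(le_trans x0).
- move=> l; apply: lerD.
    by rewrite ler_wpM2r ?exprn_ge0 ?(ltW s0)// g_homo// ler_wpM2r// exprn_ge0// ltW.
  rewrite ler_wpM2r ?invr_ge0 ?exprn_ge0 ?(ltW s0)// g_homo//.
  by rewrite ler_wpM2r// invr_ge0 exprn_ge0// ltW.
Qed.

Lemma log_periodic0 : log_periodic_sum 0 = 0.
Proof.
apply: cvg_lim => //.
have -> : log_periodic_series 0 = (fun=> 0).
  apply/funext => L; rewrite /log_periodic_series /series/= big1// => l _.
  by rewrite /a /b /g !mul0r oppr0 expR0 subrr !mul0r addr0.
exact: cvg_cst.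
Qed.

Lemma log_periodic1_gt0 : 0 < log_periodic_sum 1.
Proof.
apply: (@lt_le_trans _ _ (log_periodic_series 1 1)).
  rewrite /log_periodic_series /series/= big_nat1 ltr_pwDl ?b_ge0//.
  by rewrite /a /g expr0 !mulr1 subr_gt0 -expR0 ltr_expR oppr_lt0.
apply: nondecreasing_cvgn_le; last exact: log_periodic_cvg.
apply: nondecreasing_series => l _ _.
by apply: addr_ge0; [exact: a_ge0|exact: b_ge0].
Qed.

Lemma log_periodic_exprz (z : int) :
  log_periodic_sum (rho ^ z) = (rho ^ z) `^ al * log_periodic_sum 1.
Proof.
have step x : 0 <= x ->
    log_periodic_sum x = x `^ al * log_periodic_sum 1 <->
    log_periodic_sum (rho * x) = (rho * x) `^ al * log_periodic_sum 1.
  move=> x0; rewrite log_periodic_shift// powRM ?(ltW rho0)// -mulrA.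
  split=> [->//|]; apply: mulfI; exact/lt0r_neq0/powR_gt0.
have z0 (y : int) : 0 <= rho ^ y by rewrite exprz_ge0// ltW.
elim: z => [|n IH|n IH].
- by rewrite expr0z powR1 mul1r.
- have := (step _ (z0 n)).1 IH; rewrite -[in rho * rho ^ n]exprnP -exprS.
  by rewrite exprnP.
- apply/step => //; rewrite -{1 3}(expr1z rho) -expfzDr ?gt_eqF//.
  have -> // : 1 - n.+1%:Z = - n%:Z.
  by rewrite -addn1 PoszD opprD addrCA subrr addr0.
Qed.

(* The sum is monotone in [x] and satisfies the same functional equation under
   [x |-> rho x] as [x `^ al], so after normalization at 1 both values lie in
   the same interval [[rho^(al z), rho^(al (z + 1))]]. *)
Lemma log_periodic_approx x : 0 <= x ->
  `|log_periodic_sum x / log_periodic_sum 1 - x `^ al| <= (rho - 1) * x `^ al.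
Proof.
rewrite le_eqVlt => /predU1P[<-|x0].
  by rewrite log_periodic0 powR0 ?gt_eqF// mul0r subrr normr0 mulr0.
have lr0 : 0 < ln rho by rewrite ln_gt0.
(* Thus [rho^z <= x <= rho^(z + 1)]. *)
pose z := Num.floor (ln x / ln rho).
have rz0 : 0 < rho ^ z by rewrite exprz_gt0.
have E (y : int) : rho ^ y = expR (y%:~R * ln rho).
  by rewrite -powR_intmul ?ltW// /powR gt_eqF.
have xE : expR (ln x) = x by rewrite lnK// posrE.
have lo : rho ^ z <= x.
  rewrite -[leRHS]xE E ler_expR -ler_pdivlMr//.
  by rewrite real_floor_le ?num_real.
have hi : x <= rho * rho ^ z.
  rewrite -{1}(expr1z rho) -expfzDr ?gt_eqF//.
  rewrite -[leLHS]xE E ler_expR -ler_pdivrMr// ltW// addrC.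
  by rewrite real_floorD1_gt ?num_real.
have H1 := log_periodic1_gt0.
have rzge0 := ltW rz0.
have ral : 1 <= rho `^ al by rewrite -(powRr0 rho) ler_powR// ltW.
(* This makes the relative error [rho - 1], whatever [al]. *)
have ral' : rho `^ al <= rho by apply: ler1_powR; exact: ltW.
have plo : (rho ^ z) `^ al <= x `^ al.
  by rewrite ge0_ler_powR ?nnegrE ?(ltW al0) ?(ltW x0).
have phi : x `^ al <= rho `^ al * (rho ^ z) `^ al.
  rewrite -powRM ?(ltW rho0)// ge0_ler_powR ?nnegrE ?(ltW al0) ?(ltW x0)//.
  by rewrite mulr_ge0// ltW.
have hlo : (rho ^ z) `^ al <= log_periodic_sum x / log_periodic_sum 1.
  by rewrite ler_pdivlMr// -log_periodic_exprz log_periodic_le.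
have hhi : log_periodic_sum x / log_periodic_sum 1 <= rho `^ al * (rho ^ z) `^ al.
  rewrite ler_pdivrMr// -mulrA -log_periodic_exprz -log_periodic_shift//.
  by rewrite log_periodic_le// ltW.
have pz : 0 <= (rho ^ z) `^ al by exact: powR_ge0.
have px : 0 <= x `^ al by exact: powR_ge0.
exact: sandwich_dist ral ral' pz plo phi hlo hhi.
Qed.

End log_periodic_sum.

(** * Functions whose negative exponentials are Gaussian mixtures *)

Section bernstein.
Context {R : realType} {m : nat}.
Implicit Types (psi : 'rV[R]_m -> R) (A : 'M[R]_m).

(** The multivariate analogue of Bernstein functions, characterized by complete monotonicity of
    [exp (- c f)]. Asking for all [c >= 0] makes the class a cone. *)
Definition bernstein psi : Prop :=
  (forall x, 0 <= psi x) /\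
  forall c, 0 <= c -> mixture (fun x => expR (- (c * psi x))).

Lemma bernstein_lim (psi_ : nat -> 'rV[R]_m -> R) psi :
  (forall k, bernstein (psi_ k)) ->
  (forall x, psi_ k x @[k --> \oo] --> psi x) -> bernstein psi.
Proof.
move=> bpsi cpsi; split=> [x|c c0].
  rewrite -(cvg_lim _ (cpsi x))//; apply: limr_ge; first exact: cvgP (cpsi x).
  by near=> k; exact: (bpsi k).1.
apply: (mixture_lim (M := 1) (fun k => (bpsi k).2 c c0)) => [k x|x].
  by rewrite -expR0 ler_expR oppr_le0 mulr_ge0// (bpsi k).1.
apply: (@cvg_comp _ _ _ _ expR); last exact: continuous_expR.
by apply: cvgN; apply: cvgMr.
Unshelve. all: by end_near. Qed.

Lemma bernsteinD psi1 psi2 : bernstein psi1 -> bernstein psi2 ->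
  bernstein (fun x => psi1 x + psi2 x).
Proof.
move=> [p1 m1] [p2 m2]; split=> [x|c c0]; first exact: addr_ge0.
under eq_fun do rewrite mulrDr opprD expRD.
by apply: mixture_mul; [exact: m1|exact: m2].
Qed.

Lemma bernsteinZ a psi : 0 <= a -> bernstein psi ->
  bernstein (fun x => a * psi x).
Proof.
move=> a0 [p0 mp]; split=> [x|c c0]; first exact: mulr_ge0.
by under eq_fun do rewrite mulrA; apply: mp; exact: mulr_ge0.
Qed.

Lemma bernstein0 : bernstein (fun=> 0).
Proof.
by split=> [//|c c0]; under eq_fun do rewrite mulr0 oppr0 expR0; exact: mixture_cst.
Qed.

Lemma bernstein_sum (I : Type) (r : seq I) (psi : I -> 'rV[R]_m -> R) :
  (forall i, bernstein (psi i)) -> bernstein (fun x => \sum_(i <- r) psi i x).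
Proof.
move=> bp; elim: r => [|i r IH].
  by under eq_fun do rewrite big_nil; exact: bernstein0.
by under eq_fun do rewrite big_cons; exact: bernsteinD.
Qed.

Lemma possemidefZ a A : 0 <= a -> possemidef A -> possemidef (a *: A).
Proof.
move=> a0 [sA A0]; split=> [|x]; first by rewrite linearZ/= sA.
by rewrite quadZ mulr_ge0.
Qed.

Lemma bernstein_quad A : possemidef A -> bernstein (quad A).
Proof.
move=> pA; split=> [|c c0]; first exact: pA.2.
by under eq_fun do rewrite -quadZ; apply: mixture_gauss; exact: possemidefZ.
Qed.

(** The compound Poisson identity: [exp (- e (1 - u)) = exp (- e) exp (e u)] with [u] a Gaussian, so
    that [mixture_expR] applies. *)
Lemma bernstein_1BexpR A c : possemidef A -> 0 <= c ->
  bernstein (fun x => 1 - expR (- (c * quad A x))).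
Proof.
move=> pA c0; split=> [x|e e0].
  by rewrite subr_ge0 -expR0 ler_expR oppr_le0 mulr_ge0// pA.2.
under eq_fun do rewrite mulrBr mulr1 opprB addrC expRD.
apply: mixture_mul; first by apply: mixture_cst; exact: expR_ge0.
apply: mixture_expR; apply: mixture_mul; first exact: mixture_cst.
by under eq_fun do rewrite -quadZ; apply: mixture_gauss; exact: possemidefZ.
Qed.

Lemma bernstein_log_periodic (rho al : R) A : 1 < rho -> 0 < al -> al < 1 ->
  possemidef A -> bernstein (fun x => log_periodic_sum rho al (quad A x)).
Proof.
move=> rho1 al0 al1 pA; have rho0 : 0 < rho by exact: lt_trans rho1.
apply: (@bernstein_lim (fun k x => log_periodic_series rho al (quad A x) k)).
  move=> k; apply: bernstein_sum => l; apply: bernsteinD.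
    under eq_fun do rewrite mulrC (mulrC (quad _ _)).
    apply: bernsteinZ; first by rewrite exprn_ge0// powR_ge0.
    by apply: bernstein_1BexpR => //; rewrite exprn_ge0// ltW.
  under eq_fun do rewrite mulrC (mulrC (quad _ _)).
  apply: bernsteinZ; first by rewrite invr_ge0 exprn_ge0// powR_ge0.
  by apply: bernstein_1BexpR => //; rewrite invr_ge0 exprn_ge0// ltW.
by move=> x; apply: log_periodic_cvg => //; exact: pA.2.
Qed.

(* A discrete substitute for the subordination formula
   [x^al = c \int_0^oo (1 - exp(-x u)) u^(-1-al) du]. *)
Lemma bernstein_quad_powR (al : R) A : 0 < al -> al <= 1 -> possemidef A ->
  bernstein (fun x => quad A x `^ al).
Proof.
(* The log-periodic sum requires [al < 1]; for [al = 1], that is p = 2, the power is the form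
   itself. *)
move=> al0; rewrite le_eqVlt => /predU1P[->|al1] pA.
  rewrite (_ : (fun x => quad A x `^ 1) = quad A); first exact: bernstein_quad.
  by apply/funext => x; rewrite powRr1// pA.2.
(* With this choice the relative error [rho k - 1] is [harmonic k]. *)
pose rho k : R := 1 + harmonic k.
have rho1 k : 1 < rho k by rewrite ltrDl harmonic_gt0.
apply: (@bernstein_lim (fun k x => (log_periodic_sum (rho k) al 1)^-1 *
    log_periodic_sum (rho k) al (quad A x))) => [k|x].
  apply: bernsteinZ; last exact: bernstein_log_periodic.
  by rewrite invr_ge0 ltW// log_periodic1_gt0.
apply/subr_cvg0/norm_cvg0P.
have le0 : \forall k \near \oo,
    0 <= `|(log_periodic_sum (rho k) al 1)^-1 *
           log_periodic_sum (rho k) al (quad A x) - quad A x `^ al|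
      <= harmonic k * quad A x `^ al.
  near=> k; rewrite normr_ge0/= (mulrC _^-1).
  have -> : k.+1%:R^-1 = rho k - 1 by rewrite /rho addrC addKr.
  by apply: log_periodic_approx => //; exact: pA.2.
apply: (squeeze_cvgr le0); first exact: cvg_cst.
by rewrite -(mul0r (quad A x `^ al)); apply: cvgMl; exact: cvg_harmonic.
Unshelve. all: by end_near. Qed.

(** The function is the power [p / 2] of the rank-one form [<x, v>^2]; the bound p <= 2 keeps that
    exponent in []0, 1]]. *)
Lemma bernstein_dot_powR (p : R) (v : 'rV[R]_m) : 0 < p <= 2 ->
  bernstein (fun x => `|(x *m v^T) 0 0| `^ p).
Proof.
move=> /andP[p0 p2]; pose A := v^T *m v.
have qE x : quad A x = (x *m v^T) 0 0 ^+ 2.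
  by rewrite /A -[X in X *m v]mulmx1 -{2}(trmxK v) quad_congr quad1 big_ord1.
have pA : possemidef A.
  split=> [|x]; first by rewrite trmx_mul trmxK.
  by rewrite qE sqr_ge0.
rewrite (_ : (fun x => _) = fun x => quad A x `^ (p / 2)).
  by apply: bernstein_quad_powR => //; lra.
apply/funext => x; rewrite qE -real_normK ?num_real// -powR_mulrn//.
by rewrite -powRrM; congr (_ `^ _); field.
Qed.

End bernstein.

(** * Subspaces of Lp *)

Lemma cvg_sumr (R : realType) (I : Type) (r : seq I) (f : I -> nat -> R)
    (l : I -> R) : (forall i, f i k @[k --> \oo] --> l i) ->
  \sum_(i <- r) f i k @[k --> \oo] --> \sum_(i <- r) l i.
Proof.
move=> fl; elim: r => [|i r IHr].
  by under eq_fun do rewrite big_nil; rewrite big_nil; exact: cvg_cst.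
by under eq_fun do rewrite big_cons; rewrite big_cons; exact: cvgD.
Qed.

Lemma continuous_norm_powR (R : realType) (p : R) : 0 < p ->
  continuous (fun y : R => `|y| `^ p).
Proof.
move=> p0 c; have [->|c0] := eqVneq c 0.
  suff H : `|y| `^ p @[y --> (0 : R)] --> (0 : R).
    by rewrite /continuous_at normr0 powR0 ?gt_eqF.
  apply/cvgrPdist_lt => e e0.
  have d0 : 0 < e `^ p^-1 by exact: powR_gt0.
  exists (e `^ p^-1) => // y; rewrite /ball_/= sub0r normrN => yd.
  rewrite sub0r normrN ger0_norm ?powR_ge0//.
  have -> : e = (e `^ p^-1) `^ p.
    by rewrite -powRrM mulVf ?gt_eqF// powRr1// ltW.
  apply: gt0_ltr_powR; rewrite ?nnegrE ?(ltW d0)//.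
apply: (@continuous_comp _ _ _ (fun y : R => `|y|) (fun y => y `^ p)).
  exact: norm_continuous.
apply/differentiable_continuous/derivable1_diffP.
by apply: derivable_powR; rewrite in_itv/= andbT normr_gt0.
Qed.

(** * Finitely valued approximations of real numbers *)

Section real_quantization.
Context {R : realType}.
Local Notation mR := (measurableTypeR R).

Import HBNNSimple.

Let pospart (s : mR) : \bar R := (Num.max (s : R) 0)%:E.

Let mpospart : measurable_fun setT pospart.
Proof. by apply/measurable_EFinP; exact: measurable_maxr. Qed.

Let pospart_ge0 (s : mR) : setT s -> (0 <= pospart s)%E.
Proof. by rewrite lee_fin le_max lexx orbT. Qed.

Let q (k : nat) : {nnsfun mR >-> R} := nnsfun_approx measurableT mpospart k.

Let q_ge0 k s : 0 <= q k s. Proof. exact: fun_ge0. Qed.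

Let q_le k s : q k s <= Num.max s 0.
Proof.
by have := @le_approx _ _ _ setT pospart k s pospart_ge0 Logic.I;
  rewrite -nnsfun_approxE.
Qed.

Let q_cvg s : q k s @[k --> \oo] --> Num.max s 0.
Proof.
exact: (fine_cvg (cvg_nnsfun_approx measurableT mpospart pospart_ge0
  (Logic.I : setT s))).
Qed.

(** Simple functions below the positive part, applied to [s] and [- s]: finite range, convergence to
    [s], and no increase of the absolute value, so moments stay finite. *)
Definition quantize (k : nat) (s : R) : R := q k s - q k (- s).

Lemma measurable_quantize k : measurable_fun [set: mR] (quantize k).
Proof.
apply: measurable_funB; first exact: measurable_funPT.
by apply: (measurableT_comp (measurable_funPT (q k))).
Qed.

Lemma quantize_le k s : `|quantize k s| <= `|s|.
Proof.
rewrite /quantize; have [s0|s0] := leP 0 s.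
  have -> : q k (- s) = 0.
    apply/eqP; rewrite eq_le q_ge0 andbT (le_trans (q_le _ _))//.
    by rewrite ge_max lexx oppr_le0 s0.
  by rewrite subr0 (ger0_norm (q_ge0 _ _)) (le_trans (q_le _ _))// ger0_norm// ge_max lexx.
have -> : q k s = 0.
  apply/eqP; rewrite eq_le q_ge0 andbT (le_trans (q_le _ _))//.
  by rewrite ge_max lexx ltW.
rewrite sub0r normrN (ger0_norm (q_ge0 _ _)) (le_trans (q_le _ _))//.
by rewrite ltr0_norm// ge_max lexx oppr_ge0 ltW.
Qed.

Lemma quantize_cvg s : quantize k s @[k --> \oo] --> s.
Proof.
have E : Num.max s 0 - Num.max (- s) 0 = s.
  have [s0|/ltW s0] := leP 0 s; first by rewrite max_r ?oppr_le0// subr0.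
  by rewrite max_l ?oppr_ge0// sub0r opprK.
rewrite -[X in _ --> X]E.
by apply: cvgB; exact: q_cvg.
Qed.

Lemma quantize_finite k : exists r : seq R, forall s, quantize k s \in r.
Proof.
have /finite_seqP[r rE] := fimfunP (q k).
exists [seq x - y | x <- r, y <- r] => s; rewrite /quantize.
have H t : q k t \in r.
  have : range (q k) (q k t) by exists t.
  by rewrite rE.
exact: allpairs_f.
Qed.

End real_quantization.

Section lp_representation.
Context {R : realType} {m : nat} {dsp : measure_display} {T : measurableType dsp}.
Variables (mu : {measure set T -> \bar R}) (p : R).
Hypothesis p02 : 0 < p <= 2.

Let p0 : 0 < p. Proof. by case/andP: p02. Qed.

Let dotp (x v : 'rV[R]_m) : R := `|(x *m v^T) 0 0| `^ p.

Definition lp_moments (V : T -> 'rV[R]_m) : Prop :=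
  forall j, (\int[mu]_t (`|V t 0 j| `^ p)%:E < +oo)%E.

Let measurable_dotp (V : T -> 'rV[R]_m) x : measurable_mx V ->
  measurable_fun setT (fun t => (dotp x (V t))%:E).
Proof.
move=> mV; apply/measurable_EFinP.
apply: (measurableT_comp (measurable_powR p)); apply: measurableT_comp => //.
by apply: measurable_mulmx; [exact: measurable_mx_cst|exact: measurable_trmx].
Qed.

Let measurable_moment (V : T -> 'rV[R]_m) j : measurable_mx V ->
  measurable_fun setT (fun t => (`|V t 0 j| `^ p)%:E).
Proof.
move=> mV; apply/measurable_EFinP.
by apply: (measurableT_comp (measurable_powR p)); apply: measurableT_comp.
Qed.

(** The integral is a finite sum over the values of [V] of nonnegative multiples of [|<x, v>|^p]. *)
Lemma bernstein_simple (V : T -> 'rV[R]_m) (s : seq R) :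
  measurable_mx V -> lp_moments V -> (forall t j, V t 0 j \in s) ->
  bernstein (fun x => fine (\int[mu]_t (dotp x (V t))%:E)).
Proof.
(* Without repetitions in [s], each [t] lies in exactly one of the sets [A f] below. *)
move=> mV momV; wlog us : s / uniq s.
  move=> W Vs; apply: (W (undup s) (undup_uniq s)) => t j.
  by rewrite mem_undup.
move=> Vs; pose F := {ffun 'I_m -> 'I_(size s)}.
pose v (f : F) : 'rV[R]_m := \row_j s`_(f j).
pose A (f : F) := [set t | V t = v f].
have mA f : measurable (A f).
  rewrite [A f](_ : _ = setT `&` [set t | quad 1%:M (V t - v f) <= 0]).
    apply: measurable_fun_le => //; apply: measurable_quad => i j.
    under eq_fun do rewrite !mxE.
    by apply: measurable_funB.
  rewrite setTI; apply/seteqP; split=> t /= => [->|].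
    by rewrite subrr /quad !mul0mx mxE.
  by move=> H; apply/eqP; rewrite -subr_eq0; apply: contraTT H => /quad1_gt0; rewrite -ltNge.
have dotpE x t : dotp x (V t) = \sum_f dotp x (v f) * \1_(A f) t.
  have Vi j : (index (V t ord0 j) s < size s)%N by rewrite index_mem.
  pose f0 : F := [ffun j => Ordinal (Vi j)].
  have V0 : V t = v f0 by apply/rowP => j; rewrite !mxE ffunE/= nth_index.
  rewrite (bigD1 f0)//= indicE mem_set// mulr1 -V0 big1 ?addr0// => f ff0.
  rewrite indicE memNset ?mulr0// => Vf; move/eqP: ff0; apply.
  apply/ffunP => j; apply/val_inj/eqP; 
  rewrite -(nth_uniq 0 (ltn_ord (f j)) (ltn_ord (f0 j)) us).
  by move: Vf; rewrite /A/= V0 => /rowP/(_ j); rewrite !mxE => ->.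
(* By Chebyshev's inequality. The set where [V] vanishes may have infinite measure, but
   [dotp x 0 = 0], so the value of [fine] there is harmless. *)
have muA f : v f != 0 -> (mu (A f) < +oo)%E.
  case/rV0Pn => j vj; set c := `|v f 0 j| `^ p.
  have c0 : 0 < c by rewrite powR_gt0// normr_gt0.
  rewrite ltNge leye_eq; apply/negP => /eqP muoo; have := momV j.
  rewrite ltNge => /negP; apply.
  apply: (@le_trans _ _ (\int[mu]_t (c%:E * (\1_(A f) t)%:E))%E).
    rewrite ge0_integralZl_EFin ?(ltW c0)//; last first.
      by apply/measurable_EFinP; exact: measurable_indic.
    by rewrite integral_indic// setIT muoo gt0_muley ?lte_fin.
  apply: ge0_le_integral => //.
  - by move=> t _; rewrite -EFinM lee_fin mulr_ge0// ltW.
  - apply/measurable_EFinP/measurable_funM => //; exact: measurable_indic.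
  - exact: measurable_moment.
  - move=> t _; rewrite -EFinM lee_fin indicE.
    have [/[!inE] tA|_] := boolP (t \in A f); last by rewrite mulr0 powR_ge0.
    by rewrite mulr1 /c tA.
have -> : (fun x => fine (\int[mu]_t (dotp x (V t))%:E)) =
    (fun x => \sum_f fine (mu (A f)) * dotp x (v f)).
  apply/funext => x; rewrite -[RHS]/(fine (_%:E)) -sumEFin; congr fine.
  under eq_integral do rewrite dotpE -sumEFin.
  rewrite ge0_integral_sum//; last 2 first.
  - move=> f; apply/measurable_EFinP/measurable_funM => //.
  - by move=> f t _; rewrite lee_fin mulr_ge0// powR_ge0.
  apply: eq_bigr => f _; under eq_integral do rewrite EFinM.
  rewrite ge0_integralZl_EFin ?powR_ge0//; last first.
    by apply/measurable_EFinP; exact: measurable_indic.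
  rewrite integral_indic// setIT.
  have [->|/muA muf] := eqVneq (v f) 0.
    by rewrite /dotp trmx0 mulmx0 mxE normr0 powR0 ?gt_eqF// mul0e mulr0.
  by rewrite EFinM fineK ?ge0_fin_numE// muleC.
apply: bernstein_sum => f; apply: bernsteinZ; last exact: bernstein_dot_powR.
exact: fine_ge0.
Qed.

(** Comparison with the largest entry, which serves p < 1 and p >= 1 alike. *)
Let sum_powR_le (a : 'I_m -> R) : (forall j, 0 <= a j) ->
  (\sum_j a j) `^ p <= \sum_j (m%:R * a j) `^ p.
Proof.
move=> a0; have [j0 _|noj] := pickP 'I_m; last first.
  have H (j : 'I_m) : False by have := noj j.
  rewrite !big1 ?powR0 ?gt_eqF// => j; by case: (H j).
pose j1 := [arg max_(j > j0) a j]%O.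
have max1 j : a j <= a j1.
  by rewrite /j1; case: arg_maxP => // i _ /(_ j); exact.
apply: (@le_trans _ _ ((m%:R * a j1) `^ p)).
  apply: ge0_ler_powR; rewrite ?nnegrE ?(ltW p0) ?sumr_ge0// ?mulr_ge0//.
  apply: (@le_trans _ _ (\sum_(j < m) a j1)); first by apply: ler_sum.
  by rewrite sumr_const card_ord mulr_natl.
rewrite (bigD1 j1)//= lerDl; apply: sumr_ge0 => j _; exact: powR_ge0.
Qed.

Lemma bernstein_lp (V : T -> 'rV[R]_m) :
  measurable_mx V -> lp_moments V ->
  bernstein (fun x => fine (\int[mu]_t (dotp x (V t))%:E)).
Proof.
move=> mV momV; pose V_ k t := map_mx (quantize k) (V t).
have mV_ k : measurable_mx (V_ k).
  move=> i j; under eq_fun do rewrite mxE.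
  exact: (measurableT_comp (measurable_quantize k) (mV i j)).
have momV_ k : lp_moments (V_ k).
  move=> j; apply: le_lt_trans (momV j); apply: ge0_le_integral => //.
  - exact: measurable_moment.
  - exact: measurable_moment.
  - move=> t _; rewrite lee_fin mxE ge0_ler_powR ?nnegrE ?(ltW p0)//.
    exact: quantize_le.
apply: (@bernstein_lim _ _ (fun k x => fine (\int[mu]_t (dotp x (V_ k t))%:E))).
  move=> k; have [r qr] := @quantize_finite R k.
  apply: (@bernstein_simple _ r) => //.
  by move=> t j; rewrite mxE.
move=> x.
(* A majorant of all the integrands, independent of [k] and integrable by the moment condition. *)
pose G t : R := \sum_j ((m%:R * `|x 0 j|) `^ p * (`|V t 0 j| `^ p)).
have bound (u : 'rV[R]_m) t : (forall j, `|u 0 j| <= `|V t 0 j|) ->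
    dotp x u <= G t.
  move=> uV; apply: (@le_trans _ _ ((\sum_j `|x 0 j| * `|V t 0 j|) `^ p)).
    apply: ge0_ler_powR; rewrite ?nnegrE ?(ltW p0)// ?sumr_ge0//.
    rewrite mxE (le_trans (ler_norm_sum _ _ _))//; apply: ler_sum => j _.
    by rewrite mxE normrM ler_wpM2l.
  apply: le_trans (sum_powR_le _) _ => [j|]; first by rewrite mulr_ge0.
  by apply: ler_sum => j _; rewrite mulrA powRM// mulr_ge0.
have cdot t : (x *m (V_ k t)^T) 0 0 @[k --> \oo] --> (x *m (V t)^T) 0 0.
  rewrite mxE; under eq_fun do rewrite mxE.
  apply: (@cvg_sumr _ _ _ (fun j k => x 0 j * (V_ k t)^T j 0)) => j.
  by apply: cvgMr; rewrite mxE; under eq_fun do rewrite !mxE; exact: quantize_cvg.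
have [] := @dominated_convergence _ _ _ mu setT measurableT
    (fun k t => (dotp x (V_ k t))%:E) (fun t => (dotp x (V t))%:E)
    (fun t => (G t)%:E).
- by move=> k; exact: measurable_dotp.
- exact: measurable_dotp.
- apply: aeW => t _; apply: cvg_EFin; first by near=> k.
  exact: (cvg_comp _ _ (cdot t) (@continuous_norm_powR R p p0 _)).
- apply/integrableP; split.
    apply/measurable_EFinP; apply: measurable_sum => j.
    by apply: measurable_funM => //; apply/measurable_EFinP; exact: measurable_moment.
  under eq_integral => t _.
    rewrite gee0_abs; last first.
      by rewrite lee_fin sumr_ge0// => j _; rewrite mulr_ge0// powR_ge0.
    rewrite -sumEFin; over.
  rewrite ge0_integral_sum//; last first.
    move=> j; apply/measurable_EFinP/measurable_funM => //.
    by apply/measurable_EFinP; exact: measurable_moment.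
  apply: lte_sum_pinfty => j _; under eq_integral do rewrite EFinM.
  rewrite ge0_integralZl_EFin ?powR_ge0//; last exact: measurable_moment.
  by rewrite lte_mul_pinfty ?lee_fin ?powR_ge0//; exact: momV.
- apply: aeW => t k _; rewrite gee0_abs ?lee_fin ?powR_ge0//.
  by apply: bound => j; rewrite mxE quantize_le.
move=> intf _ H.
apply: fine_cvg; rewrite fineK//.
exact: integrable_fin_num.
Unshelve. all: by end_near. Qed.

End lp_representation.

(** * Sections of block balls *)

Section embedding.
Context {R : realType} {m : nat}.
Variables (N : 'rV[R]_m -> R) (p : R).
Hypothesis p02 : 0 < p <= 2.

(** With [V] the vector of images of the canonical basis, [J x = <x, V>] almost everywhere. The
    exceptional null set may depend on [x], since only the integral for each fixed [x] is used. *)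
Lemma bernstein_embedding :
  isometrically_embeds_Lp N p -> bernstein (fun x => N x `^ p).
Proof.
case=> dsp [T [mu [J [mJ linJ normJ]]]].
have p0 : p != 0 by case/andP: p02 => p0 _; rewrite gt_eqF.
pose V (t : T) : 'rV[R]_m := \row_j J (delta_mx 0 j) t.
have mV : measurable_mx V.
  by move=> i j; under eq_fun do rewrite mxE; exact: mJ.
have J0 : {ae mu, forall t, J 0 t = 0}.
  have := linJ 1 0 0; rewrite scaler0 addr0.
  by apply: filterS => t; rewrite mul1r => /eqP; rewrite -subr_eq0 opprD
    addrA subrr sub0r oppr_eq0 => /eqP.
have JV x : {ae mu, forall t, J x t = (x *m (V t)^T) 0 0}.
  have H (r : seq 'I_m) : {ae mu, forall t,
      J (\sum_(j <- r) x 0 j *: delta_mx 0 j) t =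
      \sum_(j <- r) x 0 j * V t 0 j}.
    elim: r => [|j r IH].
      by rewrite big_nil; apply: filterS J0 => t ->; rewrite big_nil.
    rewrite big_cons.
    have := linJ (x 0 j) (delta_mx 0 j) (\sum_(i <- r) x 0 i *: delta_mx 0 i).
    apply: filterS2 IH => t IH ->.
    by rewrite big_cons IH mxE.
  have := H (index_enum _); rewrite -row_sum_delta.
  apply: filterS => t ->; rewrite [RHS]mxE; apply: eq_bigr => j _.
  by rewrite [(V t)^T _ _]mxE.
have NE x : (\int[mu]_t (`|(x *m (V t)^T) 0 0| `^ p)%:E = (N x `^ p)%:E)%E.
  have := @poweR_Lnorm _ T R mu (EFin \o J x) p p0.
  rewrite normJ poweR_EFin => ->.
  have mpow (h : T -> R) : measurable_fun setT h ->
      measurable_fun setT (fun t => (`|h t| `^ p)%:E).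
    move=> mh; apply/measurable_EFinP.
    by apply: (measurableT_comp (measurable_powR p)); apply: measurableT_comp.
  transitivity (\int[mu]_t (`|J x t| `^ p)%:E)%E; last first.
    by apply: eq_integral => t _.
  apply: ae_eq_integral => //; [|exact: mpow|].
    apply: mpow; apply: measurable_mulmx; first exact: measurable_mx_cst.
    exact: measurable_trmx.
  by apply: filterS (JV x) => t -> _.
have -> : (fun x => N x `^ p) =
    (fun x => fine (\int[mu]_t (`|(x *m (V t)^T) 0 0| `^ p)%:E)%E).
  by apply/funext => x; rewrite NE.
apply: bernstein_lp => // j.
have -> : (\int[mu]_t (`|V t 0 j| `^ p)%:E = (N (delta_mx 0 j) `^ p)%:E)%E.
  rewrite -NE; apply: eq_integral => t _.
  by rewrite -rowE [(row _ _) _ _]mxE [(V t)^T _ _]mxE.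
exact: ltry.
Qed.

End embedding.

Section block_balls.
Context {R : realType} {m n : nat}.
Variables (N : 'rV[R]_m -> R) (p : R).
Hypotheses (p0 : 0 < p) (qN : quasi_norm N)
  (bN : bernstein (fun x => N x `^ p)).

Definition block_energy d (B : 'I_n -> 'M[R]_(d, m))
    (t : d.-tuple (measurableTypeR R)) : R :=
  \sum_i N (rowt t *m B i) `^ p.

Lemma block_energy_ge0 d (B : 'I_n -> 'M[R]_(d, m)) t : 0 <= block_energy B t.
Proof. by apply: sumr_ge0 => i _; exact: powR_ge0. Qed.

Let mixN : mixture (fun x => expR (- (N x `^ p))).
Proof.
by have := bN.2 1 ler01; under eq_fun do rewrite mul1r.
Qed.

(** Measurability of [N] comes from the embedding: [N^p] is minus the logarithm of a mixture. *)
Lemma measurable_block_energy d (B : 'I_n -> 'M[R]_(d, m)) :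
  measurable_fun setT (block_energy B).
Proof.
apply: measurable_sum => i.
have mX : measurable_mx
    (fun t : d.-tuple (measurableTypeR R) => rowt t *m B i).
  by apply: measurable_mulmx; [exact: measurable_rowt|exact: measurable_mx_cst].
have := measurable_mixture mixN mX.
move=> /(measurableT_comp (@measurable_ln R)) mL.
have -> : (fun t : d.-tuple (measurableTypeR R) => N (rowt t *m B i) `^ p) =
    (fun t => - ln (expR (- (N (rowt t *m B i) `^ p)))).
  by apply/funext => t; rewrite expRK opprK.
exact: measurableT_comp mL.
Qed.

Lemma block_energy_scalet d (B : 'I_n -> 'M[R]_(d, m)) c t : 0 < c ->
  block_energy B (scalet c t) = c `^ p * block_energy B t.
Proof.
move=> c0; rewrite /block_energy mulr_sumr; apply: eq_bigr => i _.
rewrite rowt_scalet -scalemxAl (quasi_normZ qN) gtr0_norm// powRM ?(ltW c0)//.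
exact: (quasi_norm_ge0 qN).
Qed.

(** The Gaussian factor increases to 1, so monotone convergence removes it without any integrability
    of the limit. *)
Lemma integral_block_energy_cvg d (B : 'I_n -> 'M[R]_(d, m)) :
  ((\int[lebesgue_tuple R d]_t
     (expR (- (harmonic k * quad 1%:M (rowt t))) *
      \prod_i expR (- (N (rowt t *m B i) `^ p)))%:E) @[k --> \oo] -->
   \int[lebesgue_tuple R d]_t (expR (- block_energy B t))%:E)%E.
Proof.
have prodE t : \prod_i expR (- (N (rowt t *m B i) `^ p)) =
    expR (- block_energy B t).
  by rewrite -expR_sum sumrN.
under eq_fun do under eq_integral do rewrite prodE.
have meB : measurable_fun setT (fun t => expR (- block_energy B t)).
  apply: measurableT_comp => //; apply: measurableT_comp => //.
  exact: measurable_block_energy.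
have mq (k : nat) : measurable_fun setT
    (fun t : d.-tuple (measurableTypeR R) =>
       expR (- (harmonic k * quad 1%:M (rowt t)))).
  apply: measurableT_comp => //; apply: measurableT_comp => //.
  apply: measurable_funM => //; apply: measurable_quad.
  exact: measurable_rowt.
have H t : expR (- (harmonic k * quad 1%:M (rowt t))) *
    expR (- block_energy B t) @[k --> \oo] --> expR (- block_energy B t).
  rewrite -[X in _ --> X]mul1r; apply: cvgMl.
  have c0 : - (harmonic k * quad 1%:M (rowt t)) @[k --> \oo] -->
      - (0 * quad 1%:M (rowt t)).
    by apply: cvgN; apply: cvgMl; exact: cvg_harmonic.
  rewrite mul0r oppr0 in c0.
  by have := cvg_comp _ _ c0 (@continuous_expR R 0); rewrite expR0.
have -> : (\int[lebesgue_tuple R d]_t (expR (- block_energy B t))%:E =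
  \int[lebesgue_tuple R d]_t
    (limn (fun k => (expR (- (harmonic k * quad 1%:M (rowt t))) *
      expR (- block_energy B t))%:E)))%E.
  apply: eq_integral => t _; apply/esym/cvg_lim => //.
  by apply: cvg_EFin; [exact: nearW|exact: H].
apply: cvg_monotone_convergence => //.
- by move=> k; apply/measurable_EFinP/measurable_funM.
- move=> t _ k l kl; rewrite lee_fin ler_wpM2r ?expR_ge0// ler_expR lerN2.
  rewrite ler_wpM2r ?quad1_ge0//= lef_pV2 ?posrE ?ltr0n//.
  by rewrite ler_nat ltnS.
Qed.

Lemma block_ball_le d d' (theta phi : 'rV[R]_n)
    (B : 'I_n -> 'M[R]_(d, m)) (B' : 'I_n -> 'M[R]_(d', m)) :
  block_frame theta B -> block_frame phi B' ->
  majorized (\row_i theta ord0 i ^+ 2) (\row_i phi ord0 i ^+ 2) ->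
  (lebesgue_tuple R d [set t | (block_energy B t <= 1)%R] <=
   lebesgue_tuple R d' [set t | (block_energy B' t <= 1)%R])%E.
Proof.
(* [d] and [d'] may come from different descriptions, the [\dim] of a kernel or a product of sizes;
   both frames force [d + m = n * m]. *)
move=> fB fB' tp; have dd' : d = d'.
  by case: fB fB' => [dm _ _ _] [d'm _ _ _]; apply: (@addIn m); rewrite dm d'm.
case: _ / dd' in B' fB' *.
have le_int : (\int[lebesgue_tuple R d]_t (expR (- block_energy B t))%:E <=
    \int[lebesgue_tuple R d]_t (expR (- block_energy B' t))%:E)%E.
  apply: (@lee_cvg_to _ _ _ _ _ _ _ _ (@integral_block_energy_cvg d B)
    (@integral_block_energy_cvg d B')).
  near=> k; apply: (mixture_block_le fB fB' tp mixN).
  exact: harmonic_gt0.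
move: le_int.
rewrite !(@integral_expR_homogeneous R d p)//;
  try exact: measurable_block_energy;
  try exact: block_energy_ge0;
  try by move=> c t; exact: block_energy_scalet.
have dp0 : (0 <= (d%:R / p)%:E)%E by rewrite lee_fin divr_ge0// ltW.
(* A positive finite factor cancels even against infinite measures. *)
by rewrite lee_pmul2l ?gamma_integral_gt0// gt0_fin_numE
  ?gamma_integral_lty ?gamma_integral_gt0.
Unshelve. all: by end_near. Qed.

End block_balls.

(** * Gram-Schmidt for the Euclidean structure on matrices *)

Section orthonormal_bases.
Context {R : realType} {n m : nat}.
Implicit Types (x y z : 'M[R]_(n, m)) (U : {vspace 'M[R]_(n, m)}).

Lemma edotC x y : edot x y = edot y x.
Proof.
by apply: eq_bigr => i _; apply: eq_bigr => j _; rewrite mulrC.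
Qed.

Lemma edotDl x y z : edot (x + y) z = edot x z + edot y z.
Proof.
rewrite /edot -big_split/=; apply: eq_bigr => i _.
by rewrite -big_split/=; apply: eq_bigr => j _; rewrite mxE mulrDl.
Qed.

Lemma edotZl a x z : edot (a *: x) z = a * edot x z.
Proof.
rewrite /edot mulr_sumr; apply: eq_bigr => i _.
by rewrite mulr_sumr; apply: eq_bigr => j _; rewrite mxE mulrA.
Qed.

Lemma edot_suml (I : finType) (F : I -> 'M[R]_(n, m)) z :
  edot (\sum_i F i) z = \sum_i edot (F i) z.
Proof.
apply: (big_morph (fun x => edot x z)); first by move=> x y; exact: edotDl.
by rewrite -(scale0r 0) edotZl mul0r.
Qed.

Lemma edot_ge0 x : 0 <= edot x x.
Proof.
by apply: sumr_ge0 => i _; apply: sumr_ge0 => j _; rewrite -expr2 sqr_ge0.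
Qed.

Lemma edot_gt0 x : x != 0 -> 0 < edot x x.
Proof.
move=> x0; rewrite lt_neqAle edot_ge0 andbT eq_sym; apply: contraNneq x0.
have H i : 0 <= \sum_j x i j * x i j.
  by apply: sumr_ge0 => j _; rewrite -expr2 sqr_ge0.
move=> /psumr_eq0P E; apply/eqP/matrixP => i j; rewrite mxE.
have /psumr_eq0P Ei := E (fun i _ => H i) i isT.
have x2 k : 0 <= x i k * x i k by rewrite -expr2 sqr_ge0.
have /eqP := Ei (fun k _ => x2 k) j isT.
by rewrite mulf_eq0 orbb => /eqP.
Qed.

Lemma orthonormal_family U k : (k <= \dim U)%N ->
  exists2 b : k.-tuple 'M[R]_(n, m), {subset b <= U} &
    forall i j, edot (tnth b i) (tnth b j) = (i == j)%:R.
Proof.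
elim: k => [_|k IH kU]; first by exists [tuple] => [x|[]].
have [b bU ob] := IH (ltnW kU).
have : ~~ (U <= <<b>>)%VS.
  apply: contraL kU => /dimvS Ub; rewrite -leqNgt (leq_trans Ub)//.
  by rewrite (leq_trans (dim_span _))// size_tuple.
case/subvPn => v vU vb.
pose w := v - \sum_i edot v (tnth b i) *: tnth b i.
have wb j : edot w (tnth b j) = 0.
  rewrite /w edotDl -scaleN1r edotZl edot_suml (bigD1 j)//= edotZl ob eqxx.
  rewrite big1 ?addr0 ?mulr1 ?mulN1r ?subrr// => i ij.
  by rewrite edotZl ob (negbTE ij) mulr0.
have w0 : w != 0.
  apply: contraNneq vb => /eqP; rewrite subr_eq0 => /eqP ->.
  by apply: memv_suml => i _; rewrite memvZ// memv_span// mem_tnth.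
have wU : w \in U.
  rewrite memvB// memv_suml// => i _; rewrite memvZ// bU//.
  exact: mem_tnth.
have ww := edot_gt0 w0; pose c := (Num.sqrt (edot w w))^-1.
exists [tuple of (c *: w) :: b] => [x|i j].
  by rewrite inE => /predU1P[->|/bU//]; rewrite memvZ.
have cw l : edot (c *: w) (tnth b l) = 0 by rewrite edotZl wb mulr0.
case: (unliftP ord0 i) => [i'|] ->; case: (unliftP ord0 j) => [j'|] ->;
  rewrite ?tnth0 ?tnthS.
- by rewrite ob (inj_eq lift_inj).
- by rewrite edotC cw eq_sym (negbTE (neq_lift _ _)).
- by rewrite cw (negbTE (neq_lift _ _)).
rewrite edotZl edotC edotZl mulrA -expr2 exprVn sqr_sqrtr ?(ltW ww)//.
by rewrite mulVf ?(gt_eqF ww)// eqxx.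
Qed.

Lemma orthonormal_basis_exists U :
  exists b : (\dim U).-tuple 'M[R]_(n, m), orthonormal_basis b.
Proof.
have [b bU ob] := orthonormal_family (leqnn (\dim U)).
exists b; split=> //; rewrite basisEfree size_tuple leqnn andbT.
apply/andP; split; last exact/span_subvP.
apply/freeP => a a0 i.
have := congr1 (fun x => edot x (tnth b i)) a0.
rewrite edot_suml (bigD1 i)//= edotZl -!tnth_nth ob eqxx mulr1 big1 => [|j ji].
  by rewrite addr0 => ->; rewrite -(scale0r 0) edotZl mul0r.
by rewrite edotZl -tnth_nth ob (negbTE ji) mulr0.
Qed.

End orthonormal_bases.

(** * Sections in orthonormal coordinates *)

Section block_hyperplane_measures.
Context {R : realType} {m n : nat}.
Variables (N : 'rV[R]_m -> R) (p : R).

Lemma edot_row k (theta : 'rV[R]_k) :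
  edot theta theta = \sum_i theta ord0 i ^+ 2.
Proof.
rewrite /edot big_ord1; apply: eq_bigr => i _.
by rewrite expr2.
Qed.

Lemma enorm_row_eq1 k (theta : 'rV[R]_k) :
  enorm theta = 1 <-> \sum_i theta ord0 i ^+ 2 = 1.
Proof.
rewrite -edot_row /enorm; split=> [H|->]; last by rewrite sqrtr1.
by rewrite -[LHS]sqr_sqrtr ?edot_ge0// H expr1n.
Qed.

Lemma dim_block_hyperplane (theta : 'rV[R]_n) :
  \sum_i theta ord0 i ^+ 2 = 1 ->
  (\dim (block_hyperplane m theta) + m = n * m)%N.
Proof.
move=> t1; pose f := linfun (mulmx theta : 'M[R]_(n, m) -> 'rV[R]_m).
have fT : (f @: fullv)%VS = fullv.
  apply/vspaceP => y; rewrite [RHS]memvf.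
  (* [theta^T] is a right inverse of [theta] because [theta] is a unit vector; surjectivity then
     gives the dimension of the kernel. *)
  have -> : y = f (theta^T *m y).
    rewrite lfunE/= mulmxA (_ : theta *m theta^T = 1%:M) ?mul1mx//.
    apply/matrixP => i j; rewrite !ord1 !mxE/= -t1.
    by apply: eq_bigr => k _; rewrite mxE expr2.
  by rewrite memv_img ?memvf.
have := limg_ker_dim f fullv; rewrite fT capfv !dimvf.
by rewrite /block_hyperplane -/f /dim/= mul1n.
Qed.

(** Row [k] of [B i] is the [i]-th block of the [k]-th basis vector: orthonormality becomes
    [\sum_i B i *m (B i)^T = 1], and membership in the hyperplane becomes
    [\sum_i theta_i B i = 0]. *)
Lemma subspace_measure_block (theta : 'rV[R]_n) :
  enorm theta = 1 ->
  exists d (B : 'I_n -> 'M[R]_(d, m)), block_frame theta B /\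
    subspace_measure (block_hyperplane m theta)
       (lp_ball p n N `&` [set` block_hyperplane m theta]) =
    lebesgue_tuple R d [set t | block_energy N p B t <= 1].
Proof.
move=> /enorm_row_eq1 t1; set U := block_hyperplane m theta.
pose b := xget (vbasis U) [set b | orthonormal_basis b].
have [bU ob] : orthonormal_basis b by exact: xgetPex (orthonormal_basis_exists U).
pose B i : 'M[R]_(\dim U, m) := \matrix_(k, j) (tnth b k) i j.
have inU k : tnth b k \in U by rewrite (basis_mem bU)// mem_tnth.
have rowE (t : (\dim U).-tuple (measurableTypeR R)) i :
    row i (\sum_k (tnth t k : R) *: tnth b k) = rowt t *m B i.
  apply/rowP => j; rewrite !mxE summxE; apply: eq_bigr => k _.
  by rewrite !mxE.
exists (\dim U), B; split.
  split=> //; first exact: dim_block_hyperplane.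
  - apply/matrixP => k l; rewrite summxE [RHS]mxE -ob.
    by apply: eq_bigr => i _; rewrite mxE; apply: eq_bigr => j _; rewrite !mxE.
  - apply/matrixP => k j; rewrite summxE mxE.
    have /block_hyperplaneP/rowP/(_ j) := inU k; rewrite summxE mxE => E.
    by rewrite -[RHS]E; apply: eq_bigr => i _; rewrite !mxE.
rewrite /subspace_measure -/b; congr (lebesgue_tuple _ _ _).
apply/seteqP; split=> t /=.
  by case; rewrite /lp_ball/=; under eq_bigr do rewrite rowE.
move=> Bt; split; first by rewrite /lp_ball/=; under eq_bigr do rewrite rowE.
by apply: memv_suml => k _; rewrite memvZ.
Qed.

End block_hyperplane_measures.

(** The ball with [n] blocks is the section of the ball with [n.+1] blocks by the hyperplane where
    the first block vanishes, whose normal is the first unit vector. *)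
Lemma matrix_measure_block (R : realType) (m n : nat) (N : 'rV[R]_m -> R)
    (p : R) : 0 < p -> quasi_norm N ->
  exists B : 'I_n.+1 -> 'M[R]_(n * m, m),
    block_frame (delta_mx ord0 ord0) B /\
    matrix_measure (lp_ball p n N) =
    lebesgue_tuple R (n * m) [set t | block_energy N p B t <= 1].
Proof.
move=> p0 qN.
pose B0 (i : 'I_n) : 'M[R]_(n * m, m) := \matrix_(k, j) (k == mxvec_index i j)%:R.
pose B i := if unlift ord0 i is Some i' then B0 i' else 0.
have B_0 : B ord0 = 0 by rewrite /B unlift_none.
have B_S i : B (lift ord0 i) = B0 i by rewrite /B liftK.
exists B; split.
  split.
  - by rewrite mulSn addnC.
  - rewrite big_ord_recl B_0 mul0mx add0r; apply/matrixP => k l.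
    rewrite summxE mxE; under eq_bigr do rewrite B_S mxE.
    rewrite pair_bigA/=.
    transitivity (\sum_(q : 'I_n * 'I_m)
        (k == uncurry (@mxvec_index n m) q)%:R *
        (l == uncurry (@mxvec_index n m) q)%:R : R).
      by apply: eq_bigr => -[i j] _; rewrite !mxE.
    rewrite -(reindex _ (curry_mxvec_bij n m) (P := xpredT)
      (F := fun e => (k == e)%:R * (l == e)%:R)).
    rewrite (bigD1 k)//= eqxx mul1r big1 ?addr0 => [|e ek].
      by rewrite eq_sym.
    by rewrite eq_sym (negbTE ek) mul0r.
  - rewrite big_ord_recl B_0 scaler0 add0r big1// => i _.
    by rewrite mxE/= scale0r.
  - rewrite big_ord_recl mxE/= expr1n big1 ?addr0// => i _.
    by rewrite mxE/= expr0n.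
rewrite /matrix_measure; congr (lebesgue_tuple _ _ _).
have N0 : N 0 = 0 by rewrite -(scale0r 0) (quasi_normZ qN) normr0 mul0r.
have rowE t i : rowt t *m B0 i = row i (vec_mx (rowt t)).
  apply/rowP => j; rewrite 2![RHS]mxE mxE (bigD1 (mxvec_index i j))//= big1.
    by rewrite addr0 [B0 _ _ _]mxE eqxx mulr1.
  by move=> k kij; rewrite [B0 _ _ _]mxE (negbTE kij) mulr0.
have -> : block_energy N p B =
    fun t => \sum_i N (row i (vec_mx (rowt t))) `^ p.
  apply/funext => t; rewrite /block_energy big_ord_recl B_0 mulmx0 N0.
  rewrite powR0 ?gt_eqF// add0r.
  by apply: eq_bigr => i _; rewrite B_S rowE.
by [].
Qed.

Section main.
Context {R : realType} {m : nat}.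
Variables (p : R) (N : 'rV[R]_m -> R).
Hypotheses (hp : 0 < p <= 2) (hN : quasi_norm N)
  (hemb : isometrically_embeds_Lp N p).

Let p0 : 0 < p. Proof. by case/andP: hp. Qed.

Let bN : bernstein (fun x => N x `^ p).
Proof. exact: bernstein_embedding hp hemb. Qed.

Lemma block_section_le n (theta phi : 'rV[R]_n) :
  enorm theta = 1 -> enorm phi = 1 ->
  majorized (\row_i theta ord0 i ^+ 2) (\row_i phi ord0 i ^+ 2) ->
  (subspace_measure (block_hyperplane m theta)
     (lp_ball p n N `&` [set` block_hyperplane m theta])
   <= subspace_measure (block_hyperplane m phi)
     (lp_ball p n N `&` [set` block_hyperplane m phi]))%E.
Proof.
move=> t1 f1 tf.
have [d [B [fB ->]]] := subspace_measure_block N p t1.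
have [d' [B' [fB' ->]]] := subspace_measure_block N p f1.
exact: block_ball_le fB fB' tf.
Qed.

Lemma block_section_le_ball n (theta : 'rV[R]_n) : enorm theta = 1 ->
  (subspace_measure (block_hyperplane m theta)
     (lp_ball p n N `&` [set` block_hyperplane m theta])
   <= matrix_measure (lp_ball p n.-1 N))%E.
Proof.
move=> t1; have /enorm_row_eq1 t1' := t1.
have [d [B [fB ->]]] := subspace_measure_block N p t1.
(* For [n = 0] there is no unit vector, so the predecessor in the statement is a genuine one. *)
case: n => [|n] in theta t1 t1' d B fB *.
  by move: t1'; rewrite big_ord0 => /esym/eqP; rewrite oner_eq0.
have [B' [fB' ->]] := @matrix_measure_block R m n N p p0 hN.
apply: block_ball_le fB fB' _ => //.
have -> : \row_i (delta_mx ord0 ord0 : 'rV[R]_n.+1) ord0 i ^+ 2 =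
    delta_mx ord0 ord0.
  by apply/rowP => i; rewrite !mxE; case: (_ && _); rewrite ?expr1n ?expr0n.
apply: majorized_delta => [i|]; first by rewrite mxE sqr_ge0.
by under eq_bigr do rewrite mxE.
Qed.

Lemma block_hyperplaneZ n (a : R) (theta : 'rV[R]_n) : a != 0 ->
  block_hyperplane m (a *: theta) = block_hyperplane m theta.
Proof.
move=> a0; apply/vspaceP => x.
rewrite !memv_ker !lfunE/= -scalemxAl scaler_eq0.
by rewrite (negbTE a0).
Qed.

Lemma diag_section_le n (theta : 'rV[R]_n) : enorm theta = 1 ->
  (subspace_measure (block_diag_hyperplane m)
     (lp_ball p n N `&` [set` block_diag_hyperplane m])
   <= subspace_measure (block_hyperplane m theta)
     (lp_ball p n N `&` [set` block_hyperplane m theta]))%E.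
Proof.
move=> t1; have /enorm_row_eq1 t1' := t1.
have n0 : (0 : R) < n%:R.
  rewrite ltr0n lt0n; apply/eqP => n0; move: theta t1 t1'; rewrite n0 => th _.
  by rewrite big_ord0 => /esym/eqP; rewrite oner_eq0.
(* The diagonal hyperplane is defined by the vector of ones; rescaling by [n^(-1/2)] makes it a unit
   vector and keeps the hyperplane. *)
pose a : R := Num.sqrt n%:R^-1.
have a0 : a != 0 by rewrite gt_eqF// sqrtr_gt0 invr_gt0.
have a2 : a ^+ 2 = n%:R^-1 by rewrite sqr_sqrtr// invr_ge0 ltW.
rewrite /block_diag_hyperplane -(block_hyperplaneZ _ a0).
have sqE : \row_i (a *: const_mx 1 : 'rV[R]_n) ord0 i ^+ 2 = const_mx n%:R^-1.
  by apply/rowP => i; rewrite !mxE mulr1 a2.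
apply: block_section_le => //.
  apply/enorm_row_eq1.
  transitivity (\sum_(i < n) (const_mx n%:R^-1 : 'rV[R]_n) ord0 i).
    by apply: eq_bigr => i _; rewrite -sqE [RHS]mxE.
  under eq_bigr do rewrite mxE.
  by rewrite sumr_const card_ord -[_ *+ _]mulr_natl divff// gt_eqF.
rewrite sqE; apply: majorized_const.
by under eq_bigr do rewrite mxE.
Qed.

End main.

Theorem theorem1 (R : realType) (m n : nat) (p : R) (hp : 0 < p <= 2)
    (N : 'rV[R]_m -> R) (hN : quasi_norm N)
    (hemb : isometrically_embeds_Lp N p) :
  (forall theta phi : 'rV[R]_n, enorm theta = 1 -> enorm phi = 1 ->
    majorized (\row_i theta ord0 i ^+ 2) (\row_i phi ord0 i ^+ 2) ->
    (subspace_measure (block_hyperplane m theta)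
       (lp_ball p n N `&` [set` block_hyperplane m theta])
     <= subspace_measure (block_hyperplane m phi)
       (lp_ball p n N `&` [set` block_hyperplane m phi]))%E) /\
  (forall theta : 'rV[R]_n, enorm theta = 1 ->
    (subspace_measure (block_diag_hyperplane m)
       (lp_ball p n N `&` [set` block_diag_hyperplane m])
     <= subspace_measure (block_hyperplane m theta)
       (lp_ball p n N `&` [set` block_hyperplane m theta]))%E /\
    (subspace_measure (block_hyperplane m theta)
       (lp_ball p n N `&` [set` block_hyperplane m theta])
     <= matrix_measure (lp_ball p n.-1 N))%E).
Proof.
split=> [theta phi t1 f1 tf|theta t1]; first exact: block_section_le.
by split; [exact: diag_section_le|exact: block_section_le_ball].
Qed.
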